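(* Let $\mu$ be a strict partition with $\ell(\mu)$ parts. Then \[ GQ_\mu = 2^{\ell(\mu)} \sum_{\lambda} (-1)^{\mathsf{cols}(\lambda/\mu)} (-\beta/2)^{|\lambda/\mu|}\, GP_\lambda, \] where the sum is over all strict partitions $\lambda\supseteq\mu$ with $\ell(\lambda)=\ell(\mu)$ such that $\mathsf{SD}_{\lambda/\mu}$ is a vertical strip.
   Context: A strict partition is a finite strictly decreasing sequence $\lambda=(\lambda_1>\lambda_2>\dots>\lambda_\ell>0)$ of positive integers (the empty partition $\emptyset$ is allowed); $\ell(\lambda):=\ell$ and $|\lambda|:=\sum_i\lambda_i$. The shifted diagram is $\mathsf{SD}_\lambda=\{(i,j)\in\mathbb{Z}\times\mathbb{Z}: 0<i\le j<i+\lambda_i\}$; boxes $(j,j)$ are diagonal. For strict partitions write $\mu\subseteq\lambda$ if $\mu_i\le\lambda_i$ for all $i$ (with $\mu_i=0$ for $i>\ell(\mu)$); then $\mathsf{SD}_{\lambda/\mu}:=\mathsf{SD}_\lambda\setminus\mathsf{SD}_\mu$, $|\lambda/\mu|:=|\mathsf{SD}_{\lambda/\mu}|$, and $\mathsf{cols}(\lambda/\mu)$ is the number of distinct $j$ such that $(i,j)\in\mathsf{SD}_{\lambda/\mu}$ for some $i$. $\mathsf{SD}_{\lambda/\mu}$ is a vertical strip if it contains at most one box in each row. For integers $i$ let $i':=i-\tfrac12$, so positive half-integers are ordered $1'<1<2'<2<\cdots$ ($i'$ is ''primed'', $i$ ''unprimed''). A set-valued shifted tableau $T$ of shape $\lambda$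 is a filling of $\mathsf{SD}_\lambda$ by nonempty finite sets $T_{ij}$ of positive half-integers; it is semistandard if (S1) entries weakly increase along rows (increasing $j$) and columns (increasing $i$), where $S\le S'$ means $\max S\le\min S'$; (S2) no unprimed number occurs in more than one box of a column; (S3) no primed number occurs in more than one box of a row. $\mathrm{SetShYT}_Q(\lambda)$ is the set of such tableaux and $\mathrm{SetShYT}_P(\lambda)$ the subset with no primed number in any diagonal box. Put $x^T:=\prod_i x_i^{m_i}$, where $m_i$ is the total number of occurrences of $i$ or $i'$ among the entries of $T$, and $|T|:=\sum|T_{ij}|$. With $\beta$ a commuting indeterminate, $GP_\lambda:=\sum_{T\in\mathrm{SetShYT}_P(\lambda)}\beta^{|T|-|\lambda|}x^T$ and $GQ_\lambda:=\sum_{T\in\mathrm{SetShYT}_Q(\lambda)}\beta^{|T|-|\lambda|}x^T$ in $\mathbb{Z}[\beta][[x_1,x_2,\dots]]$. *)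

(* Defs.v *)
From HB Require Import structures.
From mathcomp Require Import all_boot all_order all_algebra finmap.
From mathcomp Require Import boolp classical_sets functions cardinality fsbigop.

Set Implicit Arguments.
Unset Strict Implicit.
Unset Printing Implicit Defensive.

Import Order.TTheory GRing.Theory Num.Theory.

Local Open Scope ring_scope.
Local Open Scope fset_scope.
Local Open Scope classical_set_scope.

Definition strict_partition (la : seq nat) : bool :=
  sorted gtn la && (0%N \notin la).

(* Parts are numbered from 1 and vanish beyond the length;
   [part la 0] is a junk value, never reached inside a diagram. *)
Definition part (la : seq nat) (i : nat) : nat := nth 0%N la i.-1.

Definition subpart (mu la : seq nat) : Prop :=
  forall i : nat, (0 < i)%N -> (part mu i <= part la i)%N.

(* The outer ranges only make the comprehension finite, see [in_SD]. *)
Definition SD (la : seq nat) : {fset nat * nat} :=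
  [fset b in [seq (i, j) | i <- iota 1 (size la),
                           j <- iota 1 (size la + sumn la)]
     | (0 < b.1 <= b.2)%N && (b.2 < b.1 + part la b.1)%N].

Definition SDskew (la mu : seq nat) : {fset nat * nat} := (SD la `\` SD mu)%fset.

Definition size_skew (la mu : seq nat) : nat := #|` SDskew la mu|.

Definition cols (la mu : seq nat) : nat :=
  #|` [fset b.2 | b in SDskew la mu]|.

Definition vertical_strip (la mu : seq nat) : Prop :=
  forall i j1 j2 : nat,
    (i, j1) \in SDskew la mu -> (i, j2) \in SDskew la mu -> j1 = j2.

(* A half-integer is encoded by its double: the unprimed number i is 2i and the
   primed number i' = i - 1/2 is 2i - 1, so the order is that of nat. *)
Definition unprimed (i : nat) : nat := i.*2.
Definition primed (i : nat) : nat := i.*2.-1.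
Definition is_primed (h : nat) : bool := odd h.

(* A box carries the empty set exactly when it lies outside the shape. *)
Definition tableau := {fsfun nat * nat -> {fset nat} with fset0}.

Definition filling (la : seq nat) (T : tableau) : Prop :=
  (forall b : nat * nat, T b != fset0 <-> b \in SD la) /\
  (forall (b : nat * nat) (h : nat), h \in T b -> (0 < h)%N).

(* max S <= min S', for nonempty S and S' *)
Definition fset_le (S S' : {fset nat}) : Prop :=
  forall h h' : nat, h \in S -> h' \in S' -> (h <= h')%N.

Definition semistandard (T : tableau) : Prop :=
  [/\ forall i j j' : nat, (j < j')%N -> fset_le (T (i, j)) (T (i, j')),
      forall i i' j : nat, (i < i')%N -> fset_le (T (i, j)) (T (i', j)),
      forall i i' j h : nat, ~~ is_primed h ->
        h \in T (i, j) -> h \in T (i', j) -> i = i'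
    & forall i j j' h : nat, is_primed h ->
        h \in T (i, j) -> h \in T (i, j') -> j = j'].

Definition SetShYT_Q (la : seq nat) : set tableau :=
  [set T | filling la T /\ semistandard T].

Definition SetShYT_P (la : seq nat) : set tableau :=
  [set T | SetShYT_Q la T /\
           forall j h : nat, h \in T (j, j) -> ~~ is_primed h].

Definition size_tab (T : tableau) : nat :=
  (\sum_(b <- finsupp T) #|` T b|)%N.

Definition occ (T : tableau) (h : nat) : nat :=
  (\sum_(b <- finsupp T) (h \in T b))%N.

(* Exponent vectors of monomials in x_1, x_2, ...;
   the exponent of x_i is stored at index i - 1. *)
Definition monomial := {fsfun nat -> nat with 0%N}.

(* x^T = x^m *)
Definition has_weight (T : tableau) (m : monomial) : Prop :=
  forall i : nat, m i = (occ T (unprimed i.+1) + occ T (primed i.+1))%N.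

(* R[[x_1, x_2, ...]], a series being given by its coefficients; the
   R-module structure is the pointwise one. *)
Notation pseries R := (monomial -> R^o).

(* In {poly _}, 'X is the indeterminate beta. The index sets of the sums
   defining the coefficients are finite, see [finite_SetShYT_Q]. *)
Definition GP (la : seq nat) : pseries {poly int} := fun m =>
  \sum_(T \in [set T | SetShYT_P la T /\ has_weight T m])
     ('X^(size_tab T - sumn la) : {poly int}).

Definition GQ (la : seq nat) : pseries {poly int} := fun m =>
  \sum_(T \in [set T | SetShYT_Q la T /\ has_weight T m])
     ('X^(size_tab T - sumn la) : {poly int}).

(* Z[beta][[x]] -> Q[beta][[x]] *)
Definition toQ (f : pseries {poly int}) : pseries {poly rat} :=
  fun m => map_poly intr (f m).

(* The range of summation of the expansion, finite by [finite_strip_ext] *)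
Definition strip_ext (mu : seq nat) : set (seq nat) :=
  [set la | [/\ strict_partition la, subpart mu la, size la = size mu
              & vertical_strip la mu]].

Lemma in_SD la (b : nat * nat) :
  (b \in SD la) = (0 < b.1 <= b.2)%N && (b.2 < b.1 + part la b.1)%N.
Proof.
rewrite /SD in_fset inE; case: b => i j.
rewrite andb_idl // => /andP[/andP[/= i0 ij] /= jlt].
have ile : (i <= size la)%N.
  rewrite leqNgt; apply/negP => lti; move: jlt; rewrite /part nth_default.
    by rewrite addn0 ltnNge ij.
  by rewrite -ltnS prednK.
have ple : (part la i <= sumn la)%N.
  rewrite /part; elim: la {ile jlt} (i.-1) => [|a l IH] [|k] //=.
    exact: leq_addr.
  by apply: (leq_trans (IH k)); exact: leq_addl.
apply/allpairsP; exists (i, j); split=> //=; rewrite mem_iota add1n ltnS.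
  by rewrite i0.
by rewrite (leq_trans i0 ij) (leq_trans (ltnW jlt)) // leq_add.
Qed.

Lemma finite_SetShYT_Q la (m : monomial) :
  finite_set [set T | SetShYT_Q la T /\ has_weight T m].
Proof.
pose N := (\sum_(i <- finsupp m) i).+2.*2.
have ltN (T : tableau) b h : SetShYT_Q la T -> has_weight T m -> h \in T b ->
    (h < N)%N.
  move=> [[_ pos] _] wT hT; have h0 := pos _ _ hT.
  have occ0 : (0 < occ T h)%N.
    have bs : b \in finsupp T.
      by rewrite mem_finsupp; apply/eqP => E; rewrite E in_fset0 in hT.
    by rewrite /occ (big_fsetD1 b) //= hT.
  have mh : (0 < m (h.-1)./2)%N.
    rewrite wT /unprimed /primed.
    have [oh|eh] := boolP (odd h.-1).
      rewrite (_ : _.*2 = h) ?(leq_trans occ0) ?leq_addr //.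
      by rewrite doubleS -[RHS]prednK // -[in RHS](odd_double_half h.-1) oh.
    rewrite addnC (_ : _.-1 = h) ?(leq_trans occ0) ?leq_addr //.
    by rewrite doubleS /= -[RHS]prednK // -[in RHS](odd_double_half h.-1) (negbTE eh).
  have hs : (h.-1)./2 \in finsupp m by rewrite mem_finsupp -lt0n.
  have le : ((h.-1)./2 <= \sum_(i <- finsupp m) i)%N.
    by rewrite (big_fsetD1 _ hs) /= leq_addr.
  rewrite -leq_double in le.
  rewrite /N !doubleS -(prednK h0) -(odd_double_half h.-1) -addnS !ltnS.
  by rewrite -[leqRHS]add1n leq_add ?leq_b1 // ltnS (leq_trans le).
pose f (T : tableau) := [ffun p : SD la * 'I_N => val p.2 \in T (val p.1)].
have finj : {in [set T | SetShYT_Q la T /\ has_weight T m] &, injective f}.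
  move=> T U /set_mem[QT wT] /set_mem[QU wU] /ffunP fTU; apply/fsfunP => b.
  apply/fsetP => h.
  have [bS|bS] := boolP (b \in SD la); last first.
    have T0 : T b = fset0.
      by apply/eqP/negPn/negP => /(QT.1.1 b).1; rewrite (negbTE bS).
    have U0 : U b = fset0.
      by apply/eqP/negPn/negP => /(QU.1.1 b).1; rewrite (negbTE bS).
    by rewrite T0 U0.
  have [hN|hN] := ltnP h N.
    by have := fTU ([` bS], Ordinal hN); rewrite !ffunE.
  by apply/idP/idP => [/(ltN _ _ _ QT wT)|/(ltN _ _ _ QU wU)];
    rewrite ltnNge hN.
rewrite -(eq_finite_set (inj_card_eq finj)); exact: finite_finset.
Qed.

Lemma finite_SetShYT_P la (m : monomial) :
  finite_set [set T | SetShYT_P la T /\ has_weight T m].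
Proof.
by apply: sub_finite_set (@finite_SetShYT_Q la m) => T [[QT _] wT].
Qed.

Lemma finite_strip_ext mu : finite_set (strip_ext mu).
Proof.
pose N := (\sum_(i < size mu) nth 0%N mu i).+2.
have ltN la i : strip_ext mu la -> (i < size mu)%N -> (nth 0%N la i < N)%N.
  move=> [_ /(_ i.+1 isT)]; rewrite /part /= => sub _ vs im.
  have ub : (nth 0%N mu i <= \sum_(i < size mu) nth 0%N mu i)%N.
    by rewrite (bigD1 (Ordinal im)) //= leq_addr.
  rewrite ltnNge; apply/negP => big.
  have inS k : (k < 2)%N ->
      (i.+1, i.+1 + nth 0%N mu i + k)%N \in SDskew la mu.
    move=> k2; rewrite in_fsetD !in_SD /part /= -addnA leq_addr /=.
    rewrite !ltn_add2l -leqNgt leq_addr /=.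
    apply: leq_trans big; rewrite /N; case: k k2 => [|[|//]] _.
      by rewrite addn0 ltnS (leq_trans ub).
    by rewrite addn1 !ltnS.
  have /eqP := vs _ _ _ (inS 0%N isT) (inS 1%N isT).
  by rewrite eqn_add2l.
pose f (la : seq nat) := [ffun p : 'I_(size mu) * 'I_N => nth 0%N la p.1 == p.2].
have finj : {in strip_ext mu &, injective f}.
  move=> la nu /set_mem Ela /set_mem Enu /ffunP fE.
  have [_ _ sl _] := Ela; have [_ _ sn _] := Enu.
  apply: (@eq_from_nth _ 0%N); rewrite ?sl ?sn // => i im.
  have := fE (Ordinal im, Ordinal (ltN _ _ Ela im)).
  by rewrite !ffunE /= eqxx => /esym/eqP.
rewrite -(eq_finite_set (inj_card_eq finj)); exact: finite_finset.
Qed.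

(* Main.v *)
(** A tableau is read one letter at a time, in the order 1' < 1 < 2' < 2 < ...
    Adding the last letter enlarges a shape [nu] to a shape [la], and the total
    weight of all ways to do so is a kernel that factors over the rows: [H] for
    an unprimed letter, [V^Q] for a primed one, and [V^P] for a primed one that
    avoids the diagonal.  Let [A] be the matrix of the coefficients of the
    theorem.  It does not commute with the letters separately, but with [C] equal
    to [A] except for the last row of a shape whose last part is 1 (where staying
    has weight 2 + beta x instead of 2, and losing the row has weight x) one has
    A H = H C and V^Q A = C V^P.  Hence A (H V^P) = (H V^Q) A for each pair i', i,
    and induction on the number of variables gives GQ = A GP.  Each of the two
    relations is an identity between sums with at most two choices in each row,
    and follows by induction on the rows from a linear relation between the
    partial sums with a prescribed first part. *)

Require Import Defs.
From mathcomp Require Import all_boot all_order all_algebra finmap.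
From mathcomp Require Import boolp classical_sets functions cardinality fsbigop.
From mathcomp Require Import mpoly ring zify.

Set Implicit Arguments.
Unset Strict Implicit.
Unset Printing Implicit Defensive.

Import GRing.Theory Num.Theory.
Local Open Scope ring_scope.

(** * Kernels on strict partitions *)

(** Bounding the first part makes every matrix product a finite sum. Nothing is lost: letters never
    lengthen the first row, and a strip lengthens it by at most one box. *)
Fixpoint strict_parts (N : nat) : seq (seq nat) :=
  if N is n.+1 then strict_parts n ++ [seq n.+1 :: l | l <- strict_parts n]
  else [:: [::]].

Local Notation hd := (head 0%N).

Ltac decide_ifs := repeat match goal with
  | |- context [if ?c then _ else _] =>
      first [ rewrite (_ : c = true); [|lia] | rewrite (_ : c = false); [|lia] ]
  end.
Ltac split_ifs := repeat match goal with
  | |- context [if ?c then _ else _] =>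
      first [ rewrite (_ : c = true); [|lia] | rewrite (_ : c = false); [|lia]
            | let E := fresh "E" in have [E|E] := boolP c ]
  end.

Ltac norm_sub e := repeat match goal with
  | |- context [subn ?X ?Y] =>
      first [ rewrite (_ : subn X Y = e); [|lia] | rewrite (_ : subn X Y = e.+1); [|lia]
            | rewrite (_ : subn X Y = e.+2); [|lia] | rewrite (_ : subn X Y = 0%N); [|lia] ]
  end.

Section Kernels.
Variable R : comNzRingType.
Implicit Types (r row : nat -> nat -> nat -> nat -> R) (la mu nu : seq nat).

(* The arguments of [row] are a part of [la], the next part of [la], and the two
   corresponding parts of [nu]; missing parts are 0. *)
Fixpoint kern row la nu : R :=
  if la is a :: la' then
    row a (hd la') (hd nu) (hd (behead nu)) * kern row la' (behead nu)
  else (nu == [::])%:R.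

Definition sum_head (f : seq nat -> R) (c : nat) : R :=
  if c is c'.+1 then \sum_(l <- strict_parts c') f (c :: l) else f [::].

Lemma sum_strict_parts (f : seq nat -> R) N :
  \sum_(l <- strict_parts N) f l = \sum_(c < N.+1) sum_head f c.
Proof.
elim: N => [|N IH]; first by rewrite big_seq1 big_ord_recl big_ord0 addr0.
by rewrite /= big_cat /= IH big_map [RHS]big_ord_recr.
Qed.

(** An entry of a product of two kernels, restricted to middle shapes with first part [c] (0 for the
    empty shape). A row weight sees the next part of the middle shape, so [c] must be remembered to
    work row by row. *)
Definition mid r1 r2 mu nu c : R :=
  sum_head (fun l => kern r1 mu l * kern r2 l nu) c.

Arguments mid : simpl never.

Lemma mid_nil r1 r2 nu c : mid r1 r2 [::] nu c = ((c == 0%N) && (nu == [::]))%:R.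
Proof.
case: c => [|c]; first by rewrite /mid /= mul1r.
by rewrite /mid /= big1 // => l _; rewrite mul0r.
Qed.

Lemma mid_cons0 r1 r2 a mu nu :
  mid r1 r2 (a :: mu) nu 0 = r1 a (hd mu) 0%N 0%N * kern r1 mu [::] * (nu == [::])%:R.
Proof. by []. Qed.

(** Deleting the first row of all three shapes leaves a partial sum of the same kind, with [d] the
    next part of the middle shape. Both inductions on the rows rest on this recursion. *)
Lemma mid_consS r1 r2 a mu nu c :
  mid r1 r2 (a :: mu) nu c.+1 =
  \sum_(d < c.+1) r1 a (hd mu) c.+1 d * r2 c.+1 d (hd nu) (hd (behead nu)) *
     mid r1 r2 mu (behead nu) d.
Proof.
rewrite /mid /= sum_strict_parts; apply: eq_bigr => -[[|d] ld] _ /=.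
  by rewrite mulrACA.
by rewrite big_distrr /=; apply: eq_bigr => l _; rewrite mulrACA.
Qed.

Lemma sum_mid r1 r2 mu nu N :
  \sum_(l <- strict_parts N) kern r1 mu l * kern r2 l nu =
  \sum_(c < N.+1) mid r1 r2 mu nu c.
Proof. exact: sum_strict_parts. Qed.

(** Meant for partial sums over the first part of the middle shape, which live on two values. *)
Lemma sum_two (f : nat -> R) (i j n : nat) : i != j ->
  (forall k, k != i -> k != j -> f k = 0) ->
  \sum_(k < n) f k = (if (i < n)%N then f i else 0) + (if (j < n)%N then f j else 0).
Proof.
move=> ij f0.
rewrite (eq_bigr (fun k : 'I_n =>
   (if i == k :> nat then f i else 0) + (if j == k :> nat then f j else 0))).
  rewrite big_split /=; congr (_ + _); rewrite -big_mkcond /=.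
    case: ltnP => [lin|lin]; last by rewrite big1 // => k /eqP ik; have := ltn_ord k; lia.
    by rewrite (big_pred1 (Ordinal lin)) // => k; rewrite -val_eqE eq_sym.
  case: ltnP => [lin|lin]; last by rewrite big1 // => k /eqP ik; have := ltn_ord k; lia.
  by rewrite (big_pred1 (Ordinal lin)) // => k; rewrite -val_eqE eq_sym.
move=> k _; case: (eqVneq i k) => [<-|ik]; first by rewrite eq_sym (negbTE ij) addr0.
case: (eqVneq j k) => [<-|jk]; first by rewrite add0r.
by rewrite addr0 f0 // eq_sym.
Qed.

(** * Row weights of the strip and of the letters *)

Variables b x : R.

(* The sign comes from (-1)^cols: rows of equal right end share their new column. *)
Definition sgn (a a1 c1 : nat) : R :=
  if (a == a1.+1) && (c1 == a1.+1) then -1 else 1.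

(** Each row brings a factor 2. A new box brings -b/2 and its new column -1, so a lengthened row
    weighs b. *)
Definition strip_row (a a1 c c1 : nat) : R :=
  (if c == a then 2 else if c == a.+1 then b else 0) * sgn a a1 c1.

(** Only a part equal to 1 is treated differently from [strip_row]; in a strict partition it is the
    last part. *)
Definition mixed_row (a a1 c c1 : nat) : R :=
  (if c == a then (if a == 1%N then 2 + b * x else 2)
   else if c == a.+1 then b else if (a == 1%N) && (c == 0%N) then x else 0)
  * sgn a a1 c1.

(* The factor 1 + b x stands for the choice of adding the letter to the last box
   that a smaller letter occupies in the row. *)
Definition unprimed_row (a a1 c c1 : nat) : R :=
  if (c <= a)%N && ((a1 == 0%N) || (a1 < c)%N) then
    x ^+ (a - c) * (if (0 < c)%N && ((a1 == 0%N) || (a1.+1 < c)%N) then 1 + b * x else 1)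
  else 0.

(* [q] tells whether the diagonal is allowed. *)
Definition primed_row (q : bool) (a a1 c c1 : nat) : R :=
  if a == c then
    (if ((c1 == 0%N) || (c1.+1 < c)%N) && (q || (1 < c)%N) then 1 + b * x else 1)
  else if (a == c.+1) && (q || (0 < c)%N) then x else 0.

Definition strip_kern := kern strip_row.
Definition mixed_kern := kern mixed_row.
Definition unprimed_kern := kern unprimed_row.
Definition primed_kern q := kern (primed_row q).

Lemma strict_partition_cons a l : strict_partition (a :: l) =
  [&& (0 < a)%N, (hd l < a)%N & strict_partition l].
Proof.
rewrite /strict_partition /= inE negb_or eq_sym -lt0n.
case: l => [|c l] /=; first by case: a.
by case: (0 < a)%N; rewrite ?andbF //= -!andbA.
Qed.

Lemma strict_partition_hd0 l : strict_partition l -> (hd l == 0%N) = (l == [::]).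
Proof. by case: l => [|a l] //; rewrite strict_partition_cons; case: a. Qed.

(** * The unprimed letter: A H = H C *)

Notation LH := (mid strip_row unprimed_row).
Notation RH := (mid unprimed_row mixed_row).

(* Besides [n] itself, the only part that [mixed_row] can turn into [n]. *)
Definition alt (n : nat) := if n is n'.+1 then n' else 1%N.

Lemma strip_row_supp a a1 c c1 : c != a -> c != a.+1 -> strip_row a a1 c c1 = 0.
Proof. by rewrite /strip_row => /negbTE-> /negbTE->; rewrite mul0r. Qed.

Lemma mixed_row_supp a a1 c c1 : a != c -> a != alt c -> mixed_row a a1 c c1 = 0.
Proof.
rewrite /mixed_row /alt => ac ac'; rewrite eq_sym (negbTE ac).
case: c ac ac' => [|c] /= ac ac'; first by rewrite (negbTE ac') mul0r.
by rewrite eqSS eq_sym (negbTE ac') andbF mul0r.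
Qed.

Lemma unprimed_row_gt a a1 c c1 : (a < c)%N -> unprimed_row a a1 c c1 = 0.
Proof. by rewrite /unprimed_row ltnNge => /negbTE->. Qed.

Lemma mid_cons1S r1 r2 a nu c :
  mid r1 r2 [:: a] nu c.+1 =
  r1 a 0%N c.+1 0%N * r2 c.+1 0%N (hd nu) (hd (behead nu)) * (behead nu == [::])%:R.
Proof.
by rewrite mid_consS big_ord_recl big1 ?addr0 ?mid_nil // => i _; rewrite mid_nil mulr0.
Qed.

Lemma mid_cons2S r1 r2 a mu nu c i j : i != j ->
  (forall d, d != i -> d != j -> mid r1 r2 mu (behead nu) d = 0) ->
  mid r1 r2 (a :: mu) nu c.+1 =
  (if (i < c.+1)%N then r1 a (hd mu) c.+1 i * r2 c.+1 i (hd nu) (hd (behead nu)) *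
     mid r1 r2 mu (behead nu) i else 0) +
  (if (j < c.+1)%N then r1 a (hd mu) c.+1 j * r2 c.+1 j (hd nu) (hd (behead nu)) *
     mid r1 r2 mu (behead nu) j else 0).
Proof.
move=> ij f0; rewrite mid_consS.
pose f d := r1 a (hd mu) c.+1 d * r2 c.+1 d (hd nu) (hd (behead nu)) *
     mid r1 r2 mu (behead nu) d.
by rewrite (@sum_two f i j) // /f => k ki kj; rewrite f0 ?mulr0.
Qed.

(** Equality of the totals is not inductive, since a further row weighs the two possible first parts
    differently. On the left the ratio 2 : bx of the two partial sums supplies what is missing; on
    the right the total suffices. *)
Lemma strip_unprimed_inv mu nu : strict_partition mu -> strict_partition nu -> mu != [::] ->
  [/\ forall c, c != hd mu -> c != (hd mu).+1 -> LH mu nu c = 0,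
      forall c, (c < hd nu)%N -> LH mu nu c = 0,
      forall k, (hd mu < k)%N -> RH mu nu k = 0,
      forall k, k != hd nu -> k != alt (hd nu) -> RH mu nu k = 0 &
      ((hd nu <= hd mu)%N -> exists Z, [/\ LH mu nu (hd mu) = 2 * Z,
         LH mu nu (hd mu).+1 = b * x * Z &
         RH mu nu (hd nu) = (2 + b * x) * Z - RH mu nu (alt (hd nu))]) /\
      (hd nu = (hd mu).+1 -> LH mu nu (hd mu).+1 = RH mu nu (hd mu))].
Proof.
elim: mu nu => [//|a mu IH] nu; rewrite strict_partition_cons => /and3P[a0 ma spm] spn _ /=.
have nu0 := strict_partition_hd0 spn.
split.
- case=> [|c] c1 c2; first by rewrite mid_cons0 strip_row_supp ?mul0r.
  by rewrite mid_consS big1 // => d _; rewrite strip_row_supp ?mul0r.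
- case=> [|c] c1; first by rewrite mid_cons0 -nu0 (gtn_eqF c1) mulr0.
  by rewrite mid_consS big1 // => d _; rewrite unprimed_row_gt ?mulr0 ?mul0r.
- case=> [//|c] c1.
  by rewrite mid_consS big1 // => d _; rewrite unprimed_row_gt ?mul0r.
- case=> [|c] c1 c2; first by rewrite mid_cons0 -nu0 eq_sym (negbTE c1) mulr0.
  by rewrite mid_consS big1 // => d _; rewrite mixed_row_supp ?mulr0 ?mul0r.
case: nu => [|b0 nu] in spn nu0 *.
  have [mu0|mu0] := eqVneq mu [::].
    rewrite {}mu0 in ma IH spm *.
    split=> [_|//]; exists (x ^+ a); rewrite !mid_cons1S !mid_cons0 /=.
    case: a a0 ma => // a _ ma; rewrite !mid_cons1S /strip_row /mixed_row /unprimed_row /sgn /=.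
    by decide_ifs; rewrite ?(subSS, subn0) ?exprS; split; ring.
  have m0 : (0 < hd mu)%N by rewrite lt0n strict_partition_hd0.
  (* Either product loses at most the last row, so with at least two rows in [mu] everything
     vanishes at the empty [nu]. *)
  split=> [_|//]; exists 0.
  have L0 c : LH (a :: mu) [::] c = 0.
    case: c => [|c]; first by rewrite mid_cons0 strip_row_supp ?mul0r //; lia.
    have [I1 _ _ _ _] := IH [::] spm isT mu0.
    rewrite (@mid_cons2S _ _ _ _ [::] _ _ _ _ I1); last lia.
    by rewrite /unprimed_row /=; split_ifs; rewrite ?(mulr0, mul0r, addr0).
  have R0 c : RH (a :: mu) [::] c = 0.
    case: c => [|c]; first by rewrite mid_cons0 /unprimed_row; decide_ifs; rewrite !mul0r.
    rewrite mid_consS big1 // => d _; rewrite /unprimed_row /mixed_row /=.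
    by split_ifs; rewrite ?(mulr0, mul0r).
  by rewrite !L0 !R0 !mulr0 subr0.
move: (spn); rewrite strict_partition_cons => /and3P[b0_gt0 nb spn'] /=.
case: a a0 ma => // a _ ma; case: b0 b0_gt0 nb spn nu0 => // b0 _ nb spn nu0 /=.
have [mu0|mu0] := eqVneq mu [::].
  rewrite {}mu0 in ma IH spm *.
  case: nu nb spn nu0 spn' => [|n nu] nb spn nu0 spn'; last first.
    have Z r1 r2 c : mid r1 r2 [:: a.+1] [:: b0.+1, n & nu] c = 0.
      by case: c => [|c]; rewrite ?mid_cons0 ?mid_cons1S mulr0.
    by rewrite !Z; split=> // _; exists 0; rewrite !mulr0 subrr.
  split=> [ba|[->]]; last by rewrite !mid_cons1S /strip_row /mixed_row /unprimed_row /sgn /=;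
    decide_ifs; ring.
  (* For one row, Z is the weight of the unprimed letter on a row shrinking from a+1 to b0+1. *)
  exists (x ^+ (a - b0) * (1 + b * x)).
  case: b0 {spn nu0} nb ba => [|b0] nb ba;
    rewrite !mid_cons1S ?mid_cons0 /strip_row /mixed_row /unprimed_row /sgn /=.
    by decide_ifs; rewrite ?(subSS, subn0) ?exprS; split; ring.
  have [e ea] : exists e, a = (b0.+1 + e)%N by exists (a - b0.+1)%N; lia.
  by decide_ifs; norm_sub e; rewrite ?exprS; split; ring.
have m0 : (0 < hd mu)%N by rewrite lt0n strict_partition_hd0.
have [I1 I2 I3 I4 [I5 I6]] := IH nu spm spn' mu0.
have mm : hd mu != (hd mu).+1 by lia.
have nn : hd nu != alt (hd nu) by rewrite /alt; case: (hd nu) => //= k; lia.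
have LE c := @mid_cons2S _ _ a.+1 mu (b0.+1 :: nu) c _ _ mm I1.
have RE c := @mid_cons2S _ _ a.+1 mu (b0.+1 :: nu) c _ _ nn I4.
have R0 : RH (a.+1 :: mu) (b0.+1 :: nu) 0 = 0 by rewrite mid_cons0 mulr0.
rewrite /= in LE RE.
move: I1 I2 I3 I4 I5 I6 LE RE R0.
move: (LH (a.+1 :: mu) _) (RH (a.+1 :: mu) _) => L R1.
move: (hd mu) (hd nu) (LH mu nu) (RH mu nu) ma m0 nb mm nn
   => m n L' R' ma m0 nb mm nn I1 I2 I3 I4 I5 I6 LE RE R0.
(* An unprimed letter leaves a first part larger than the second part of the shape it starts from,
   so both sides vanish when b0+1 is at most m. *)
have [bm|mb] := leqP b0.+1 m.
  have L0 c : L c.+1 = 0 by rewrite LE /unprimed_row; split_ifs; rewrite ?(mulr0, mul0r, addr0).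
  have {R0} R0 c : (c <= b0.+1)%N -> R1 c = 0.
    by case: c => // c cb; rewrite RE /unprimed_row; split_ifs; rewrite ?(mulr0, mul0r, addr0).
  split=> [_|ba]; last by rewrite L0 R0 //; lia.
  by exists 0; rewrite !L0 !R0 ?mulr0 ?subr0 //; lia.
case: b0 => [|b0] in nb spn nu0 LE RE mb *; first by lia.
have [n2|n2] := leqP m.+2 n.
  have L0 c : L c.+1 = 0.
    by rewrite LE !I2 ?mulr0; try lia; split_ifs; rewrite addr0.
  have {R0} R0 c : R1 c = 0.
    have mn : (m < alt n)%N by move: n2; rewrite /alt; case: (n) => //= n'; lia.
    by case: c => // c; rewrite RE !I3 ?mulr0 //; try lia; split_ifs; rewrite addr0.
  by split=> [_|_]; last rewrite L0 R0 //; exists 0; rewrite !L0 !R0 ?mulr0 ?subr0.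
(* When n = m+1, a single partial sum of the tails survives on each side, and [I6] equates the
   two. *)
have [n1|n1] := ltnP m n.
  have ? : n = m.+1 by lia.
  subst n; have I6' := I6 erefl.
  rewrite !LE !RE {}I6' (I2 m) // (I3 m.+1) // !mulr0 /strip_row /mixed_row /unprimed_row /sgn /=.
  split=> [ba|ba].
    exists (x ^+ (a - b0.+1) * (if (m.+2 < b0.+2)%N then 1 + b * x else 1) * R' m).
    have [e ea] : exists e, a = (b0.+1 + e)%N by exists (a - b0.+1)%N; lia.
    by split_ifs; norm_sub e; rewrite ?exprS; split; ring.
  by split_ifs; norm_sub 0%N; rewrite ?expr0; ring.
have [Z [EL0 EL1 ER]] := I5 n1.
rewrite !LE !RE EL0 EL1 ER /strip_row /mixed_row /unprimed_row /sgn /=.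
move: (R' (alt n)) => r.
have altn : (alt n <= m)%N by move: n1; rewrite /alt; case: (n) => //= n'; lia.
clear IH I1 I2 I3 I4 I5 I6 LE RE ER EL0 EL1 R0 spm spn spn' nu0.
split=> [ba|ba].
  have [e ea] : exists e, a = (b0.+1 + e)%N by exists (a - b0.+1)%N; lia.
  (* The left partial sums of the tails are 2Z at d = m and bxZ at d = m+1. The letter weighs them
     by 1+bx, 1 or 0 according as d+1 is below, equal to or above the part b0+2 of [nu]; the three
     cases are the resulting sums. *)
  exists (x ^+ e * (if b0.+1 == m then 2 else if b0 == m then 2 + 3 * b * x
     else (1 + b * x) * (2 + b * x)) * Z).
  by split_ifs; norm_sub e; rewrite ?exprS; split; ring.
by split_ifs; norm_sub 0%N; rewrite ?expr0; ring.
Qed.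

(** The strip acts first on the left and may lengthen the first row, hence the strict bound for [N];
    on the right the letter acts first. *)
Lemma strip_unprimed_commute N M mu nu : strict_partition mu -> strict_partition nu ->
  (hd mu < N)%N -> (hd mu <= M)%N ->
  \sum_(l <- strict_parts N) strip_kern mu l * unprimed_kern l nu =
  \sum_(k <- strict_parts M) unprimed_kern mu k * mixed_kern k nu.
Proof.
move=> spm spn mN mM; rewrite !sum_mid.
have [mu0|mu0] := eqVneq mu [::].
  by rewrite mu0 2!big_ord_recl !big1 ?addr0 ?mid_nil // => i _; rewrite mid_nil.
have m0 : (0 < hd mu)%N by rewrite lt0n strict_partition_hd0.
have [I1 I2 I3 I4 [I5 I6]] := strip_unprimed_inv spm spn mu0.
have mm : hd mu != (hd mu).+1 by lia.
have nn : hd nu != alt (hd nu) by rewrite /alt; case: (hd nu) => //= k; lia.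
rewrite (sum_two _ mm I1) (sum_two _ nn I4).
have [nm|nm] := leqP (hd nu) (hd mu).
  have [Z [-> -> ->]] := I5 nm.
  have an : (alt (hd nu) <= hd mu)%N by move: nm; rewrite /alt; case: (hd nu) => //= k; lia.
  by decide_ifs; ring.
have -> : LH mu nu (hd mu) = 0 by apply: I2; lia.
have -> : RH mu nu (hd nu) = 0 by apply: I3; lia.
have [nm2|nm2] := eqVneq (hd nu) (hd mu).+1.
  by rewrite I6 // nm2 /=; split_ifs; rewrite !add0r.
rewrite I2 ?I3; first by split_ifs.
  by move: nm nm2; rewrite /alt; case: (hd nu) => //= k; lia.
by lia.
Qed.

(** * The primed letter: V^Q A = C V^P *)

Notation LV := (mid (primed_row true) strip_row).
Notation RV := (mid mixed_row (primed_row false)).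

(** Both products change the first part by at most one, which gives the three cases at the end. For
    equal first parts, [v] records how the common total splits between the two middle values, as the
    induction needs. *)
Lemma primed_strip_inv rho nu : strict_partition rho -> strict_partition nu -> rho != [::] ->
  [/\ forall c, c != hd rho -> c != (hd rho).-1 -> LV rho nu c = 0,
      forall c, c != hd nu -> c.+1 != hd nu -> LV rho nu c = 0,
      forall l, l != hd rho -> l != (hd rho).+1 -> ~~ ((hd rho == 1%N) && (l == 0%N)) ->
        RV rho nu l = 0,
      forall l, l != hd nu -> l != (hd nu).+1 -> RV rho nu l = 0 &
      [/\ hd nu = hd rho -> exists v, [/\
            RV rho nu (hd rho).+1 = b * x * v,
            LV rho nu (hd rho).-1 = RV rho nu (hd rho) - (2 + b * x) * v &
            LV rho nu (hd rho) = 2 * (1 + b * x) * v],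
          hd nu = (hd rho).+1 -> LV rho nu (hd rho) = RV rho nu (hd nu) &
          (hd nu).+1 = hd rho -> LV rho nu (hd nu) = RV rho nu (hd nu) + RV rho nu (hd rho)]].
Proof.
elim: rho nu => [//|a rho IH] nu; rewrite strict_partition_cons => /and3P[a0 ma spm] spn _ /=.
have nu0 := strict_partition_hd0 spn.
split.
- have v0 a1 c c1 : c != a -> c != a.-1 -> primed_row true a a1 c c1 = 0.
    by move=> h1 h2; rewrite /primed_row; decide_ifs.
  case=> [|c] c1 c2; first by rewrite mid_cons0 v0 ?mul0r.
  by rewrite mid_consS big1 // => d _; rewrite v0 ?mul0r.
- case=> [|c] c1 c2; first by rewrite mid_cons0 -nu0 eq_sym (negbTE c1) mulr0.
  by rewrite mid_consS big1 // => d _; rewrite strip_row_supp ?mulr0 ?mul0r // eq_sym.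
- have c0 a1 c c1 : c != a -> c != a.+1 -> ~~ ((a == 1%N) && (c == 0%N)) ->
  mixed_row a a1 c c1 = 0.
    by move=> h1 h2 h3; rewrite /mixed_row; decide_ifs; rewrite mul0r.
  case=> [|c] c1 c2 c3; first by rewrite mid_cons0 c0 ?mul0r.
  by rewrite mid_consS big1 // => d _; rewrite c0 ?mul0r.
- have v0 c a1 c1 : c != hd nu -> c != (hd nu).+1 -> primed_row false c a1 (hd nu) c1 = 0.
    by move=> h1 h2; rewrite /primed_row; decide_ifs.
  case=> [|c] c1 c2; first by rewrite mid_cons0 -nu0 eq_sym (negbTE c1) mulr0.
  by rewrite mid_consS big1 // => d _; rewrite v0 ?mulr0 ?mul0r.
have [rho0|rho0] := eqVneq rho [::].
  rewrite {}rho0 in ma IH spm *.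
  case: nu spn nu0 => [|b0 [|n nu]] spn nu0 /=.
  - split; first by lia.
      by [].
    (* On the left a primed letter on the diagonal removes the row of length 1. On the right this is
       forbidden, and [mixed_row] supplies the weight x instead. *)
    move=> <-; rewrite !mid_cons0 mid_cons1S /mixed_row /primed_row /sgn /=.
    by decide_ifs; ring.
  - case: b0 spn nu0 => // b0 spn nu0; case: a a0 ma => // a _ ma.
    split=> [[<-]|[->]|[<-]]; rewrite ?mid_cons1S /mixed_row /primed_row /strip_row /sgn /=;
      last 2 first.
      by split_ifs; ring.
      by split_ifs; ring.
    (* For both parts equal to 1 the left total is 2(1+bx), while lengthening the row and shortening
       it again gives bx on the right. The remaining 2+bx is the special weight in [mixed_row]. *)
    exists 1; case: b0 {spn nu0} => [|b0];
      rewrite ?mid_cons0 ?mid_cons1S /mixed_row /primed_row /strip_row /sgn /=.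
      by split; ring.
    by split_ifs; split; ring.
  - have Z r1 r2 c : mid r1 r2 [:: a] [:: b0, n & nu] c = 0.
      by case: c => [|c]; rewrite ?mid_cons0 ?mid_cons1S mulr0.
    by rewrite !Z; split=> // _; [exists 0; rewrite ?Z !mulr0 subr0 | rewrite addr0].
have m0 : (0 < hd rho)%N by rewrite lt0n strict_partition_hd0.
case: nu spn nu0 => [|b0 nu] spn nu0 /=; first by split; lia.
move: (spn); rewrite strict_partition_cons => /and3P[b0_gt0 nb spn'] /=.
have [I1 I2 I3 I4 [I5 I6 I7]] := IH nu spm spn' rho0.
case: a a0 ma => [|[|a]] // _ ma; first by lia.
case: b0 b0_gt0 nb spn nu0 => // b0 _ nb spn nu0 /=.
have mm : hd rho != (hd rho).-1 by lia.
have nn : hd nu != (hd nu).+1 by lia.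
have LE c := @mid_cons2S _ _ a.+2 rho (b0.+1 :: nu) c _ _ mm I1.
have RE c := @mid_cons2S _ _ a.+2 rho (b0.+1 :: nu) c _ _ nn I4.
rewrite /= in LE RE.
move: I1 I2 I3 I4 I5 I6 I7 LE RE.
move: (LV (a.+2 :: rho) _) (RV (a.+2 :: rho) _) => L R1.
move: (hd rho) (hd nu) (LV rho nu) (RV rho nu) ma m0 nb mm nn
   => p n L' R' ma m0 nb mm nn I1 I2 I3 I4 I5 I6 I7 LE RE.
clear IH spm spn nu0 spn'.
case: p => // p in ma m0 mm I1 I2 I3 I5 I6 I7 LE RE *; rewrite /= in mm I1 LE *.
(* All that is needed of the tails, whose first parts are p+1 and n: these are equal, differ by one
   in either direction, or all four partial sums vanish. *)
suff main : [\/ L' p.+1 = 0 /\ L' p = 0 /\ R' n = 0 /\ R' n.+1 = 0,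
   n = p.+1 /\ (exists u v : R, R' n = u /\ R' n.+1 = b * x * v /\ L' p = u - (2 + b * x) * v /\
     L' p.+1 = 2 * (1 + b * x) * v),
   n = p.+2 /\ (exists u : R, L' p = 0 /\ L' p.+1 = u /\ R' n = u /\ R' n.+1 = 0) |
   n = p /\ (exists u w : R, L' p.+1 = 0 /\ L' p = u + w /\ R' n = u /\ R' n.+1 = w)].
  clear I1 I2 I3 I4 I5 I6 I7.
  split=> [[ba]|[ba]|[ba]]; rewrite ?LE ?RE.
  (* Read off from the right partial sum at a+3: there the first row weighs b and then x, and only
     the sign depends on the tail. *)
  - exists (sgn a.+2 p.+1 n * R' n + sgn a.+2 p.+1 n.+1 * R' n.+1).
    rewrite ?LE ?RE; clear LE RE; subst b0; rewrite /strip_row /primed_row /mixed_row /sgn /=.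
    case: main => [[-> [-> [-> ->]]]|[? [u [v [-> [-> [-> ->]]]]]]|[? [u [-> [-> [-> ->]]]]]
      |[? [u [w [-> [-> [-> ->]]]]]]]; try subst n.
    + by split_ifs; rewrite ?mulr0 ?addr0; split; ring.
    + by split_ifs; split; ring.
    + by split_ifs; split; ring.
    + by split_ifs; split; ring.
  - rewrite ?LE ?RE; clear LE RE; subst b0; rewrite /strip_row /primed_row /mixed_row /sgn /=.
    case: main => [[-> [-> [-> ->]]]|[? [u [v [-> [-> [-> ->]]]]]]|[? [u [-> [-> [-> ->]]]]]
      |[? [u [w [-> [-> [-> ->]]]]]]]; try subst n.
    + by split_ifs; rewrite ?mulr0 ?addr0.
    + by split_ifs; ring.
    + by split_ifs; ring.
    + by split_ifs; ring.
  - rewrite ?LE ?RE; clear LE RE; subst b0; rewrite /strip_row /primed_row /mixed_row /sgn /=.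
    case: main => [[-> [-> [-> ->]]]|[? [u [v [-> [-> [-> ->]]]]]]|[? [u [-> [-> [-> ->]]]]]
      |[? [u [w [-> [-> [-> ->]]]]]]]; try subst n.
    + by split_ifs; rewrite ?mulr0 ?addr0.
    + by split_ifs; ring.
    + by split_ifs; ring.
    + by split_ifs; ring.
have [np1|np1] := eqVneq n p.+1.
  apply: Or42; split=> //; have [v [E1 E2 E3]] := I5 np1.
  by exists (R' n), v; rewrite np1.
have [np2|np2] := eqVneq n p.+2.
  apply: Or43; split=> //; exists (R' n).
  have -> : L' p = 0 by apply: I2; lia.
  have -> : R' n.+1 = 0 by apply: I3; lia.
  by rewrite I6.
have [np|np] := eqVneq n p.
  apply: Or44; split=> //; exists (R' n), (R' n.+1).
  have -> : L' p.+1 = 0 by apply: I2; lia.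
  by rewrite -np I7 ?np.
have -> : L' p = 0 by apply: I2; lia.
have -> : L' p.+1 = 0 by apply: I2; lia.
have -> : R' n = 0 by apply: I3; lia.
have -> : R' n.+1 = 0 by apply: I3; lia.
exact: Or41.
Qed.

Lemma primed_strip_commute N M rho nu : strict_partition rho -> strict_partition nu ->
  (hd rho < N)%N -> (hd rho <= M)%N ->
  \sum_(k <- strict_parts M) primed_kern true rho k * strip_kern k nu =
  \sum_(l <- strict_parts N) mixed_kern rho l * primed_kern false l nu.
Proof.
move=> spm spn mN mM; rewrite !sum_mid.
have [rho0|rho0] := eqVneq rho [::].
  by rewrite rho0 big_ord_recl [RHS]big_ord_recl !big1 ?addr0 ?mid_nil // => i _;
    rewrite mid_nil.
have m0 : (0 < hd rho)%N by rewrite lt0n strict_partition_hd0.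
have [I1 I2 I3 I4 [I5 I6 I7]] := primed_strip_inv spm spn rho0.
have mm : hd rho != (hd rho).-1 by lia.
have nn : hd nu != (hd nu).+1 by lia.
rewrite (sum_two _ mm I1) (sum_two _ nn I4).
move: I1 I2 I3 I4 I5 I6 I7; move: (hd rho) (hd nu) (LV rho nu) (RV rho nu) mN mM m0 mm nn.
move=> p n L R1 mN mM m0 mm nn I1 I2 I3 I4 I5 I6 I7.
have [np1|np1] := eqVneq n p.
  have [v [E1 E2 E3]] := I5 np1.
  by subst n; rewrite E1 E2 E3; clear I1 I2 I3 I4 I5 I6 I7; decide_ifs; ring.
have [np2|np2] := eqVneq n p.+1.
  have -> : L p.-1 = 0 by apply: I2; lia.
  have -> : R1 n.+1 = 0 by apply: I3; lia.
  rewrite I6 //.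
  by clear I1 I2 I3 I4 I5 I6 I7; decide_ifs; split_ifs.
have [np|np] := eqVneq n.+1 p.
  have -> : L p = 0 by apply: I2; lia.
  have -> : p.-1 = n by lia.
  rewrite I7 //.
  by clear I1 I2 I3 I4 I5 I6 I7; subst p; decide_ifs; ring.
have -> : L p = 0 by apply: I2; lia.
have -> : L p.-1 = 0 by apply: I2; lia.
have -> : R1 n = 0 by apply: I3; lia.
have -> : R1 n.+1 = 0 by apply: I3; lia.
by clear I1 I2 I3 I4 I5 I6 I7; split_ifs.
Qed.

End Kernels.

(** * The list of bounded strict partitions *)

Lemma mem_strict_parts N l : (l \in strict_parts N) = strict_partition l && (hd l <= N)%N.
Proof.
elim: N l => [|N IH] l /=.
  by case: l => [|a l] //; rewrite strict_partition_cons inE; case: a => [|a] //=;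
    rewrite andbF.
rewrite mem_cat IH.
have -> : (l \in [seq N.+1 :: l0 | l0 <- strict_parts N]) =
  strict_partition l && (hd l == N.+1).
  apply/mapP/andP => [[l' + ->]|[]].
    by rewrite IH => /andP[spl lN]; rewrite strict_partition_cons /= spl eqxx ltnS lN.
  case: l => [|a l] //; rewrite strict_partition_cons => /and3P[_ la spl] /eqP/= aN; subst a.
  by exists l; rewrite // IH spl -ltnS.
by rewrite -andb_orr [in RHS]leq_eqVlt ltnS orbC.
Qed.

Lemma uniq_strict_parts N : uniq (strict_parts N).
Proof.
elim: N => [|N IH] //=; rewrite cat_uniq IH map_inj_uniq ?IH ?andbT; last by move=> ? ? [].
apply/hasPn => _ /mapP[l _ ->]; rewrite mem_strict_parts /=.
by rewrite negb_and ltnn orbT.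
Qed.

(** * One pair of letters at a time *)

Section Transfer.
Variables (R : comNzRingType) (b : R) (x : nat -> R) (N : nat).

Lemma unprimed_kern_gt y mu k : (hd mu < hd k)%N -> unprimed_kern b y mu k = 0.
Proof.
case: mu => [|a mu] /=; first by case: k.
by move=> ak; rewrite /unprimed_kern /= unprimed_row_gt ?mul0r.
Qed.

Lemma primed_kern_gt q y mu k : (hd mu < hd k)%N -> primed_kern b y q mu k = 0.
Proof.
case: mu => [|a mu] /=; first by case: k.
by move=> ak; rewrite /primed_kern /= /primed_row; decide_ifs; rewrite mul0r.
Qed.

(* The letter h + 1, encoded as in [unprimed] and [primed], carries the variable
   of index h / 2 and is unprimed when h is odd. *)
Definition letter_kern q h : seq nat -> seq nat -> R :=
  if odd h then unprimed_kern b (x h./2) else primed_kern b (x h./2) q.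

(** Letters are peeled off from the largest to the smallest. By [sum_tabs] this is the weighted sum
    over the tableaux with letters up to [h]. *)
Fixpoint letter_sum q h (la : seq nat) : R :=
  if h is h'.+1 then \sum_(nu <- strict_parts N) letter_kern q h' la nu * letter_sum q h' nu
  else (la == [::])%:R.

Lemma strip_kern_nil mu : strict_partition mu -> strip_kern b mu [::] = (mu == [::])%:R.
Proof.
case: mu => [|a mu] //; rewrite strict_partition_cons => /and3P[a0 _ _].
by rewrite /strip_kern /= strip_row_supp ?mul0r //; lia.
Qed.

(** The expansion in n variables. The induction step carries A across one pair of letters: H V^Q A =
    H C V^P = A H V^P. *)
Lemma letter_sum_expansion n mu : strict_partition mu -> (hd mu < N)%N ->
  letter_sum true n.*2 mu = \sum_(la <- strict_parts N) strip_kern b mu la *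
    letter_sum false n.*2 la.
Proof.
elim: n mu => [|n IH] mu spm mN.
  rewrite (bigD1_seq [::]) ?uniq_strict_parts ?mem_strict_parts //= strip_kern_nil // mulr1.
  by rewrite big1 ?addr0 // => l /negbTE->; rewrite mulr0.
set y := x n.
have KV q : letter_kern q n.*2 = primed_kern b y q by rewrite /letter_kern odd_double doubleK.
have KH q : letter_kern q n.*2.+1 = unprimed_kern b y
  by rewrite /letter_kern /= odd_double /= uphalf_double.
rewrite doubleS.
transitivity (\sum_(k <- strict_parts N) \sum_(l <- strict_parts N)
   unprimed_kern b y mu k * mixed_kern b y k l * letter_sum false n.*2.+1 l).
  rewrite [LHS]/= KH !big_seq; apply: eq_bigr => k; rewrite mem_strict_parts => /andP[spk _].
  (* Terms where the first part grows vanish; in the others it stays below [N], as the commutation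
     lemmas and the induction hypothesis require. *)
  have [kmu|kmu] := ltnP (hd mu) (hd k).
    by rewrite unprimed_kern_gt // mul0r big1 // => l _; rewrite !mul0r.
  under [RHS]eq_bigr do rewrite -mulrA; rewrite -[RHS]big_distrr /=; congr (_ * _).
  rewrite KV.
  transitivity (\sum_(t <- strict_parts N) (\sum_(r <- strict_parts N) primed_kern b y true k r * strip_kern b r t)
     * letter_sum false n.*2 t).
    under [RHS]eq_bigr do rewrite big_distrl /=.
    rewrite exchange_big /= !big_seq; apply: eq_bigr => r.
    rewrite mem_strict_parts => /andP[spr _].
    have [kr|kr] := ltnP (hd k) (hd r).
      by rewrite primed_kern_gt // mul0r big1 // => l _; rewrite !mul0r.
    rewrite IH //; last by apply: leq_ltn_trans mN; apply: leq_trans kmu.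
    by rewrite big_distrr /=; apply: eq_bigr => t _; rewrite mulrA.
  transitivity (\sum_(t <- strict_parts N) (\sum_(l <- strict_parts N) mixed_kern b y k l *
    primed_kern b y false l t)
     * letter_sum false n.*2 t).
    rewrite !big_seq; apply: eq_bigr => t; rewrite mem_strict_parts => /andP[spt _].
    by rewrite (@primed_strip_commute _ _ _ N) //;
      [apply: leq_ltn_trans mN | apply: leq_trans (ltnW mN)].
  under [LHS]eq_bigr do rewrite big_distrl /=.
  rewrite exchange_big /=; apply: eq_bigr => l _; rewrite KV big_distrr /=.
  by apply: eq_bigr => t _; rewrite mulrA.
rewrite exchange_big /=.
transitivity (\sum_(l <- strict_parts N) (\sum_(la <- strict_parts N) strip_kern b mu la *
  unprimed_kern b y la l)
   * letter_sum false n.*2.+1 l).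
  rewrite !big_seq; apply: eq_bigr => l; rewrite mem_strict_parts => /andP[spl _].
  by rewrite (@strip_unprimed_commute _ _ y N N) // ?big_distrl // ltnW.
under [LHS]eq_bigr do rewrite big_distrl /=.
rewrite exchange_big /=; apply: eq_bigr => la _; rewrite KH big_distrr /=.
by apply: eq_bigr => l _; rewrite mulrA.
Qed.

End Transfer.

(** * Adding the last letter to a tableau *)

Local Open Scope fset_scope.

(** * Strict partitions and shifted diagrams *)

Lemma part_strict la i : strict_partition la -> (0 < i)%N ->
  part la i.+1 = 0%N \/ (part la i.+1 < part la i)%N.
Proof.
case: i => // i spl _; rewrite /part /=.
elim: la i spl => [|a la IH] i; first by left; rewrite nth_nil.
rewrite strict_partition_cons => /and3P[_ la1 spl]; case: i => [|i] /=; last exact: IH.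
by right; move: la1; rewrite -nth0.
Qed.

Lemma mem_SDP la i j : reflect [/\ (0 < i)%N, (i <= j)%N & (j < i + part la i)%N] ((i, j) \in SD la).
Proof.
rewrite in_SD /=; apply: (iffP andP) => [[/andP[-> ->] ->]|[-> -> ->]] //.
Qed.

(** Going up one row moves the start of the row left by one, and strictness keeps its right end from
    receding. *)
Lemma SD_up la i i' j : strict_partition la -> (0 < i)%N -> (i <= i')%N ->
  (i', j) \in SD la -> (i, j) \in SD la.
Proof.
move=> spl i0; elim: i' => [|i' IH] ii'; first by lia.
have [->//|ne] := eqVneq i i'.+1.
move=> /mem_SDP[_ ij jp]; have i'0 : (0 < i')%N by lia.
apply: IH; first by lia.
by apply/mem_SDP; split=> //; [lia|]; case: (part_strict spl i'0); lia.
Qed.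

Lemma eq_parts la mu : strict_partition la -> strict_partition mu ->
  (forall i, (0 < i)%N -> part la i = part mu i) -> la = mu.
Proof.
move=> spl spm E.
have sz l l' : strict_partition l -> (forall i, (0 < i)%N -> part l i = part l' i) ->
  (size l <= size l')%N.
  move=> /andP[_ l0] E'; case: (posnP (size l)) => [->//|sl].
  have : nth 0%N l (size l).-1 \in l by rewrite mem_nth // prednK.
  have := E' _ sl; rewrite /part => ->.
  apply: contraLR; rewrite -ltnNge => ll; rewrite nth_default //.
  by rewrite -ltnS prednK.
apply: (@eq_from_nth _ 0%N); last by move=> i _; have := E i.+1 isT.
by apply/eqP; rewrite eqn_leq !sz // => i i0; rewrite E.
Qed.

Lemma SD_inj la mu : strict_partition la -> strict_partition mu -> (forall c, (c \in SD la) =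
  (c \in SD mu)) -> la = mu.
Proof.
move=> spl spm E; apply: eq_parts => // i i0.
have key l l' : (forall c, c \in SD l -> c \in SD l') -> (part l i <= part l' i)%N.
  move=> S; rewrite leqNgt; apply/negP => lt.
  have /S/mem_SDP[_ _] : (i, (i + part l' i)%N) \in SD l by apply/mem_SDP; split; lia.
  by lia.
by apply/eqP; rewrite eqn_leq !key // => c; rewrite E.
Qed.

Lemma hd_part la : hd la = part la 1.
Proof. by rewrite /part nth0. Qed.

(* In a row of length [a] the smaller letters occupy the first [c] boxes and the
   last letter (unprimed if [u]) all boxes from position [s] on; [a1] and [c1]
   are the lengths in the next row. For [u], that the shared box is a corner of
   the inner shape follows from the condition on [a1], since [c1 <= a1]. *)
Definition row_ok (u q : bool) (a a1 c c1 s : nat) : bool :=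
  [&& (s <= c)%N, (c <= a)%N, (c <= s.+1)%N &
   if u then (a1 == 0%N) || (a1 < s)%N else
   [&& (a <= s.+1)%N, (s == c) || (c1 == 0%N) || (c1.+1 < c)%N & q || (0 < s)%N]].

Definition row_starts u q a a1 c c1 : seq nat :=
  [seq s <- (if c is c'.+1 then [:: c; c'] else [:: 0%N]) | row_ok u q a a1 c c1 s].

Fixpoint starts (u q : bool) (la nu : seq nat) : seq (seq nat) :=
  if la is a :: la' then
    [seq s :: sg | s <- row_starts u q a (hd la') (hd nu) (hd (behead nu)),
                   sg <- starts u q la' (behead nu)]
  else if nu == [::] then [:: [::]] else [::].

Lemma mem_row_starts u q a a1 c c1 s :
  (s \in row_starts u q a a1 c c1) = row_ok u q a a1 c c1 s.
Proof.
rewrite mem_filter andb_idr // /row_ok => /and4P[sc ca cs _].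
by case: c sc ca cs => [|c] sc ca cs; rewrite !inE; lia.
Qed.

Lemma uniq_starts u q la nu : uniq (starts u q la nu).
Proof.
elim: la nu => [|a la IH] nu /=; first by case: eqP.
apply: allpairs_uniq => //; last by move=> [s sg] [s' sg'] _ _ /= [-> ->].
by apply: filter_uniq; case: (hd nu) => [|c] //=; rewrite inE; lia.
Qed.

Lemma mem_startsP u q la nu sg :
  reflect [/\ size sg = size la, (size nu <= size la)%N & forall i, (i < size la)%N ->
    row_ok u q (nth 0%N la i) (nth 0%N la i.+1) (nth 0%N nu i) (nth 0%N nu i.+1) (nth 0%N sg i)]
   (sg \in starts u q la nu).
Proof.
elim: la nu sg => [|a la IH] nu sg /=.
  case: eqP => [->|/eqP nu0]; last first.
    by constructor; rewrite leqn0 size_eq0 (negbTE nu0); case.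
  by rewrite inE; apply: (iffP eqP) => [->|[/size0nil]].
apply: (iffP allpairsP) => [[[s sg'] /= [+ /IH[ssg snu ok] ->]]|].
  rewrite mem_row_starts => ok0; split=> /=; first by rewrite ssg.
    by move: snu; rewrite size_behead; lia.
  case=> [|i] /= il; first by rewrite !nth0 -[nth 0%N nu 1]nth_behead nth0.
  by have := ok i il; rewrite !nth_behead.
case: sg => [|s sg] [//= [ssg] snu ok]; exists (s, sg) => /=; split=> //.
  have := ok 0%N isT; rewrite mem_row_starts /= !nth0.
  by rewrite -[nth 0%N nu 1]nth_behead nth0.
by apply/IH; split=> //; [rewrite size_behead; lia | move=> i il; rewrite !nth_behead;
  exact: (ok i.+1)].
Qed.

(** The row conditions restated for parts with any positive index, also beyond the length, so that
    arguments about boxes need not count rows. *)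
Record shape_ok (u q : bool) (la nu sg : seq nat) : Prop := ShapeOk {
  start_le : forall i, (0 < i)%N -> (part sg i <= part nu i)%N;
  inner_le : forall i, (0 < i)%N -> (part nu i <= part la i)%N;
  inner_start : forall i, (0 < i)%N -> (part nu i <= (part sg i).+1)%N;
  corner : forall i, (0 < i)%N -> (part sg i < part nu i)%N ->
    part nu i.+1 = 0%N \/ ((part nu i.+1).+1 < part nu i)%N;
  unprimed_strip : u -> forall i, (0 < i)%N -> part la i.+1 =
    0%N \/ (part la i.+1 < part sg i)%N;
  primed_strip : ~~ u -> forall i, (0 < i)%N -> (part la i <= (part sg i).+1)%N;
  primed_diag : ~~ u -> ~~ q -> forall i, (0 < i)%N -> part sg i = 0%N -> part la i = 0%N }.

Lemma shape_okP u q la nu sg : strict_partition la ->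
  sg \in starts u q la nu <-> [/\ size sg =
    size la, (size nu <= size la)%N & shape_ok u q la nu sg].
Proof.
move=> spl; split=> [/mem_startsP[ssg snu ok]|[ssg snu ok]].
  split=> //.
  have ok' i : (0 < i)%N ->
    row_ok u q (part la i) (part la i.+1) (part nu i) (part nu i.+1) (part sg i)
     \/ (part la i = 0 /\ part nu i = 0 /\ part sg i = 0 /\ part la i.+1 = 0)%N.
    case: i => // i _; rewrite /part /=; have [il|il] := ltnP i (size la); first by left;
      apply: ok.
    by right; do !split; rewrite nth_default //; lia.
  have le i : (0 < i)%N -> (part nu i <= part la i)%N.
    by move=> /ok' [/and4P[]|]; lia.
  split=> // [i|i|i i0|uu i i0|/negbTE uu i i0|/negbTE uu /negbTE qq i i0].
  - by move=> /ok' [/and4P[]|]; lia.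
  - by move=> /ok' [/and4P[]|]; lia.
  - case: (ok' i i0); last by lia.
    have := le i.+1 isT; rewrite /row_ok; case: (u); lia.
  - by case: (ok' i i0); rewrite /row_ok ?uu; lia.
  - by case: (ok' i i0); rewrite /row_ok ?uu; lia.
  - by case: (ok' i i0); rewrite /row_ok ?uu ?qq; lia.
apply/mem_startsP; split=> // i il.
have la0 : nth 0%N la i != 0%N.
  by apply: contraTneq spl => E; rewrite /strict_partition negb_and negbK -E mem_nth // orbT.
case: ok => /(_ i.+1 isT) o1 /(_ i.+1 isT) o2 /(_ i.+1 isT) o3 /(_ i.+1 isT) o4.
rewrite /row_ok; move: o1 o2 o3 o4 la0; rewrite /part /=.
case: u => /= o1 o2 o3 o4 la0 o5 o6 o7.
  by have := o5 isT i.+1 isT; rewrite /part /=; lia.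
have := o6 isT i.+1 isT; rewrite /part /=.
by case: q o7 => [_|/(_ isT isT i.+1 isT)]; rewrite /part /=; lia.
Qed.

Lemma sumn_hd l : sumn l = (hd l + sumn (behead l))%N.
Proof. by case: l. Qed.

Lemma starts_sumn u q la nu sg : sg \in starts u q la nu ->
  (sumn sg <= sumn nu)%N /\ (sumn nu <= sumn la)%N.
Proof.
elim: la nu sg => [|a la IH] nu sg /=; first by case: eqP => // ->; rewrite inE => /eqP->.
move=> /allpairsP[[s sg'] /= [+ /IH[le1 le2] ->]]; rewrite mem_row_starts => /and4P[sc ca _ _].
by rewrite (sumn_hd nu) /=; split; apply: leq_add.
Qed.

(** * Letter kernels as sums over start positions *)

Section StartsSum.
Variables (R : comNzRingType) (b y : R).

(** Start c contributes y^(a-c). Start c-1 shares one box with a smaller letter and contributes by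
    times as much; the two together give the factor 1+by. *)
Lemma sum_row_starts u q a a1 c c1 : (0 < a)%N ->
  \sum_(s <- row_starts u q a a1 c c1) y ^+ (a - s) * b ^+ (c - s) =
  (if u then unprimed_row b y else primed_row b y q) a a1 c c1.
Proof.
move=> a0; rewrite /row_starts big_filter.
case: c => [|c]; rewrite ?big_cons big_nil /row_ok /unprimed_row /primed_row ?subnn ?subSnn.
  case: u => /=; first by split_ifs; rewrite ?expr0; ring.
  by split_ifs; norm_sub 0%N; rewrite ?expr0 ?expr1; try ring.
case: u => /=.
  have [ca|ca] := leqP c.+1 a; last by split_ifs; rewrite ?addr0.
  have [e ea] : exists e, a = (c.+1 + e)%N by exists (a - c.+1)%N; lia.
  by split_ifs; norm_sub e; rewrite ?exprS ?expr0; ring.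
by case: q => /=; split_ifs; norm_sub 0%N; rewrite ?expr0 ?expr1; try ring.
Qed.

(** The exponent of y counts the boxes that receive the letter, that of b the boxes shared with
    smaller letters. *)
Lemma sum_starts u q la nu : strict_partition la ->
  \sum_(sg <- starts u q la nu) y ^+ (sumn la - sumn sg) * b ^+ (sumn nu - sumn sg) =
  kern (if u then unprimed_row b y else primed_row b y q) la nu.
Proof.
elim: la nu => [|a la IH] nu /=; first by case: eqP => [->|]; rewrite ?big_seq1 ?big_nil ?mulr1.
rewrite strict_partition_cons => /and3P[a0 _ spl];
  rewrite big_allpairs_dep /= -sum_row_starts //.
rewrite big_distrl /= !big_seq; apply: eq_bigr => s; rewrite mem_row_starts =>
  /and4P[sc ca _ _].
rewrite -IH // big_distrr /= !big_seq; apply: eq_bigr => sg /starts_sumn[le1 le2].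
rewrite (sumn_hd nu) mulrACA -!exprD; congr (_ ^+ _ * _ ^+ _); lia.
Qed.

End StartsSum.

(** * Tableaux with bounded letters *)

Definition in_strip (la sg : seq nat) (c : nat * nat) : bool :=
  [&& (0 < c.1)%N, (c.1 + part sg c.1 <= c.2)%N & (c.2 < c.1 + part la c.1)%N].

Definition add_letter (h : nat) (la sg : seq nat) (T : tableau) : tableau :=
  [fsfun c in SD la => T c `|` (if in_strip la sg c then [fset h] else fset0)].

Definition restrict (h : nat) (la : seq nat) (T : tableau) : tableau :=
  [fsfun c in SD la => [fset k in T c | (k <= h)%N]].

(** Tableaux of type Q for [q = true] and of type P otherwise. The bound is an encoded half-integer:
    h = 2n allows the letters up to n. *)
Definition bounded_tab (q : bool) (h : nat) (la : seq nat) (T : tableau) : Prop :=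
  [/\ filling la T, semistandard T,
      ~~ q -> forall j k, k \in T (j, j) -> ~~ is_primed k &
      forall c k, k \in T c -> (k <= h)%N].

Lemma bounded_mem q h la T c k : bounded_tab q h la T -> k \in T c ->
  [/\ c \in SD la, (0 < k)%N & (k <= h)%N].
Proof.
move=> [[f1 f2] _ _ bd] kT; split; [|exact: f2 kT|exact: bd kT].
by apply/f1/negP => /eqP E; rewrite E in_fset0 in kT.
Qed.

Section AddLetter.
Variables (q : bool) (h : nat) (la nu sg : seq nat) (T : tableau).
Hypotheses (spl : strict_partition la) (spn : strict_partition nu) (ok : shape_ok (odd h) q la nu sg).
Hypothesis (TT : bounded_tab q h nu T).

Lemma SD_inner c : c \in SD nu -> c \in SD la.
Proof.
case: c => i j /mem_SDP[i0 ij jn]; apply/mem_SDP; split=> //.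
by have := inner_le ok i0; lia.
Qed.

Lemma mem_add_letter c k :
  (k \in add_letter h.+1 la sg T c) = (k \in T c) || ((k == h.+1) && in_strip la sg c).
Proof.
rewrite fsfunE; case: ifP => [cS|cS].
  by rewrite in_fsetU; case: ifP => _; rewrite ?inE ?andbT ?andbF.
rewrite inE; apply/esym/negbTE; rewrite negb_or; apply/andP; split.
  apply: contraFN cS => /(bounded_mem TT)[cn _ _]; exact: SD_inner.
apply: contraFN cS => /andP[_]; case: c => i j /and3P[/= i0 ij jl]; apply/mem_SDP;
  split=> //; lia.
Qed.

Lemma add_letterP c k : k \in add_letter h.+1 la sg T c ->
   [/\ k \in T c, c \in SD nu, (0 < k)%N & (k <= h)%N] \/ k = h.+1 /\ in_strip la sg c.
Proof.
rewrite mem_add_letter => /orP[kT|/andP[/eqP -> ?]]; last by right.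
by left; case: (bounded_mem TT kT).
Qed.

(** Each condition has its source: [start_le] fills all boxes, [inner_start] orders rows, [corner]
    orders columns, [unprimed_strip] and [primed_strip] prevent repetitions, and [primed_diag]
    protects the diagonal. *)
Lemma add_letter_bounded : bounded_tab q h.+1 la (add_letter h.+1 la sg T).
Proof.
have [[fT1 fT2] [S1 S2 S3 S4] dT bd] := TT.
split; first split.
- move=> c; split=> [|cl].
    case/fset0Pn => k /add_letterP[[_ /SD_inner //]|[_]].
    by case: c => i j /and3P[/= i0 ij jl]; apply/mem_SDP; split=> //; lia.
  have [cn|cn] := boolP (c \in SD nu).
    have /fset0Pn[k kT] := (fT1 c).2 cn.
    by apply/fset0Pn; exists k; rewrite mem_add_letter kT.
  apply/fset0Pn; exists h.+1; rewrite mem_add_letter eqxx /=; apply/orP; right.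
  case: c cl cn => i j /mem_SDP[i0 ij jl] /mem_SDP cn; apply/and3P; split=> //=.
  have := start_le ok i0; rewrite leqNgt => sn; apply/negP => jn; apply: cn; split=> //.
  by lia.
- by move=> c k /add_letterP[[]|[->]].
- split.
  + move=> i j j' jj' k k' /add_letterP[[kT kn k0 kh]|[-> ks]] /add_letterP[[kT' kn' k0' kh']|[-> ks']] //.
    * exact: (S1 _ _ _ jj' _ _ kT kT').
    * by lia.
    * move: ks kn' => /and3P[/= i0 ij jl] /mem_SDP[_ _ jn].
      by have := inner_start ok i0; lia.
  + move=> i i' j ii' k k' /add_letterP[[kT kn k0 kh]|[-> ks]] /add_letterP[[kT' kn' k0' kh']|[-> ks']] //.
    * exact: (S2 _ _ _ ii' _ _ kT kT').
    * by lia.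
    * move: ks => /and3P[/= i0 ij jl].
      have /mem_SDP[_ ij1 j1] : (i.+1, j) \in SD nu by apply: SD_up kn'.
      (* Below a shared box [corner] leaves no box of [nu]; if no box is shared, the strip of row i
         lies outside [nu], and strictness rules out a box of [nu] below it. *)
      have [|] := ltnP (part sg i) (part nu i).
        by move=> lt; have := corner ok i0 lt; have := inner_start ok i0; lia.
      by have := part_strict spn i0; lia.
  + move=> i i' j k ek /add_letterP[[kT kn k0 kh]|[kE ks]] /add_letterP[[kT' kn' k0' kh']|[kE' ks']].
    * exact: S3 kT kT'.
    * by lia.
    * by lia.
    have uh : odd h by move: ek; rewrite /is_primed kE /= negbK.
    have aux i1 i2 : (i1 < i2)%N -> in_strip la sg (i1, j) -> in_strip la sg (i2, j) -> False.
      move=> lt /and3P[/= i0 ij jl] /and3P[/= i0' ij' jl'].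
      have /mem_SDP[_ ij1 j1] : (i1.+1, j) \in SD la by apply: (@SD_up _ _ i2) => //;
        apply/mem_SDP; split; lia.
      by have := unprimed_strip ok uh i0; lia.
    by case: (ltngtP i i') => // lt; [case: (aux _ _ lt ks ks') | case: (aux _ _ lt ks' ks)].
  + move=> i j j' k ek /add_letterP[[kT kn k0 kh]|[kE ks]] /add_letterP[[kT' kn' k0' kh']|[kE' ks']].
    * exact: S4 kT kT'.
    * by lia.
    * by lia.
    have uh : ~~ odd h by move: ek; rewrite /is_primed kE.
    move: ks ks' => /and3P[/= i0 ij jl] /and3P[/= _ ij' jl'].
    by have := primed_strip ok uh i0; lia.
- move=> qq j k /add_letterP[[kT kn k0 kh]|[kE ks]]; first exact: (dT qq _ _ kT).
  rewrite kE /is_primed; apply/negP => /= uh.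
  move: ks => /and3P[/= i0 ij jl].
  by have := primed_diag ok uh qq i0; lia.
- by move=> c k /add_letterP[[_ _ _]|[->]] //; apply: leqW.
Qed.

End AddLetter.

(** * Removing the last letter *)

(** The row lengths left after removing a letter are listed with one entry per row of the large
    shape, so trailing zeros have to be dropped. *)
Lemma trim_zeros l :
  (forall i, nth 0%N l i.+1 = 0%N \/ (nth 0%N l i.+1 < nth 0%N l i)%N) ->
  exists nu, [/\ strict_partition nu, (size nu <= size l)%N & forall i, nth 0%N nu i =
    nth 0%N l i].
Proof.
elim: l => [|a l IH] dec; first by exists [::].
have [nu [spn snu nuE]] := IH (fun i => dec i.+1).
case: (posnP a) => [a0|a0]; last first.
  exists (a :: nu); split=> [||[|i]] //=.
  by rewrite strict_partition_cons a0 spn andbT -nth0 nuE; case: (dec 0%N) => /=; lia.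
exists [::]; split=> // i; rewrite nth_nil; elim: i => [|i IHi] //.
by case: (dec i); lia.
Qed.

(** Turns monotonicity along a row into one cut position, which is [n] when the predicate never
    holds. *)
Lemma find_iota (P : pred nat) n : (forall k k', (k < k' < n)%N -> P k -> P k') ->
  (find P (iota 0 n) <= n)%N /\ forall k, (k < n)%N -> P k = (find P (iota 0 n) <= k)%N.
Proof.
move=> up; have fn : (find P (iota 0 n) <= n)%N by rewrite -[leqRHS](size_iota 0) find_size.
split=> // k kn; case: leqP => [fk|kf]; last first.
  by have /= := @before_find _ 0%N P _ _ kf; rewrite nth_iota.
have Pf : P (find P (iota 0 n)).
  have : has P (iota 0 n) by rewrite has_find size_iota; apply: leq_ltn_trans kn.
  by move=> /(nth_find 0%N); rewrite nth_iota // (leq_ltn_trans fk).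
case: (ltngtP (find P (iota 0 n)) k) fk => // [fk _|<- //].
by apply: up Pf; rewrite fk.
Qed.

Section Restrict.
Variables (q : bool) (h : nat) (la : seq nat) (T : tableau).
Hypotheses (spl : strict_partition la) (TT : bounded_tab q h.+1 la T).

Let T' := restrict h la T.

Lemma mem_restrict c k : (k \in T' c) = (k \in T c) && (k <= h)%N.
Proof.
rewrite fsfunE; case: ifP => cS; first by rewrite !inE.
rewrite inE; apply/esym/negbTE; apply: contraFN cS => /andP[kT _].
by case: (bounded_mem TT kT).
Qed.

Definition inner_len i := find (fun k => T' (i, i + k)%N == fset0) (iota 0 (part la i)).
Definition start_pos i := find (fun k => h.+1 \in T (i, i + k)%N) (iota 0 (part la i)).

Lemma tab_nonempty i j : (i, j) \in SD la -> exists k, k \in T (i, j).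
Proof. by case: TT => -[f1 _] _ _ _ /f1 /fset0Pn. Qed.

Lemma box_mem i k : (0 < i)%N -> (k < part la i)%N -> (i, (i + k)%N) \in SD la.
Proof. by move=> i0 kl; apply/mem_SDP; split; lia. Qed.

Lemma inner_lenP i : (0 < i)%N -> (inner_len i <= part la i)%N /\
  forall j, (i, j) \in SD la -> (T' (i, j) != fset0) = (j < i + inner_len i)%N.
Proof.
move=> i0; have [_ [S1 _ _ _] _ _] := TT.
have := @find_iota (fun k => T' (i, i + k)%N == fset0) (part la i).
case=> [k k' /andP[kk' kl] /eqP Tk|le E].
  apply/negPn/negP => /fset0Pn[m']; rewrite mem_restrict => /andP[mT' mh].
  have [m mT] := tab_nonempty (box_mem i0 (ltn_trans kk' kl)).
  have mm' : (m <= m')%N by apply: (S1 i (i + k)%N (i + k')%N _ _ _ mT mT'); lia.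
  have : m \in T' (i, (i + k)%N) by rewrite mem_restrict mT; lia.
  by rewrite Tk inE.
split=> // j /mem_SDP[_ ij jl]; have := E (j - i)%N; rewrite subnKC // => ->; last by lia.
by rewrite -ltnNge /inner_len; lia.
Qed.

Lemma start_posP i : (0 < i)%N -> (start_pos i <= part la i)%N /\
  forall j, (i, j) \in SD la -> (h.+1 \in T (i, j)) = (i + start_pos i <= j)%N.
Proof.
move=> i0; have [_ [S1 _ _ _] _ bd] := TT.
have := @find_iota (fun k => h.+1 \in T (i, i + k)%N) (part la i).
case=> [k k' /andP[kk' kl] Tk|le E].
  have [m mT] := tab_nonempty (box_mem i0 kl).
  have := S1 i (i + k)%N (i + k')%N _ _ _ Tk mT; have := bd _ _ mT => mh.
  rewrite ltn_add2l => /(_ kk') hm; suff <- : m = h.+1 by [].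
  by apply/eqP; rewrite eqn_leq mh.
split=> // j /mem_SDP[_ ij jl]; have := E (j - i)%N; rewrite subnKC // => ->; last by lia.
by rewrite /start_pos; lia.
Qed.

Lemma small_or_last i j : (i, j) \in SD la -> T' (i, j) = fset0 -> h.+1 \in T (i, j).
Proof.
move=> /tab_nonempty[k kT] T0; have [_ _ kh] := bounded_mem TT kT.
have [kh'|kh'] := leqP k h; last by suff <- : k = h.+1 by []; lia.
have : k \in T' (i, j) by rewrite mem_restrict kT kh'.
by rewrite T0 inE.
Qed.

Lemma last_above_small i i' j j' : h.+1 \in T (i, j) -> T' (i', j') != fset0 ->
  ((i == i') && (j < j')%N) || ((j == j') && (i < i')%N) -> False.
Proof.
have [_ [S1 S2 _ _] _ _] := TT.
move=> hT /fset0Pn[k]; rewrite mem_restrict => /andP[kT kh].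
case/orP => /andP[/eqP E lt]; subst; first by have := S1 _ _ _ lt _ _ hT kT; lia.
by have := S2 _ _ _ lt _ _ hT kT; lia.
Qed.

(** In each row the boxes with a smaller letter form an initial segment and those with the last
    letter a final one; the cut positions are [nu] and [sg]. *)
Lemma restrict_tab : exists nu sg, [/\ strict_partition nu, (hd nu <= hd la)%N,
  sg \in starts (odd h) q la nu, bounded_tab q h nu T' & T = add_letter h.+1 la sg T'].
Proof.
have [[f1 f2] [S1 S2 S3 S4] dT bd] := TT.
pose nul := mkseq (fun i => inner_len i.+1) (size la).
pose sg := mkseq (fun i => start_pos i.+1) (size la).
have len0 i : (size la < i)%N -> part la i = 0%N by move=> il; rewrite /part nth_default //;
  lia.
have nulE i : (0 < i)%N -> part nul i = inner_len i.
  case: i => // i _; rewrite /part /=; have [il|il] := ltnP i (size la); first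
    by rewrite nth_mkseq.
  by rewrite nth_default ?size_mkseq // /inner_len len0.
have sgE i : (0 < i)%N -> part sg i = start_pos i.
  case: i => // i _; rewrite /part /=; have [il|il] := ltnP i (size la); first
    by rewrite nth_mkseq.
  by rewrite nth_default ?size_mkseq // /start_pos len0.
have [|nu [spn snu nuE]] := @trim_zeros nul.
  move=> i; have := nulE i.+2 isT; have := nulE i.+1 isT; rewrite /part /= => -> ->.
  have [le1 E1] := inner_lenP (isT : 0 < i.+1)%N.
  have [le2 E2] := inner_lenP (isT : 0 < i.+2)%N.
  case: (posnP (inner_len i.+2)) => [->|n0]; [by left | right].
  (* This is the last box of row i+2 with a small entry. The box above it must hold a small entry
     too, so row i+1 has more of them. *)
  have b2 : (i.+2, (i.+1 + inner_len i.+2)%N) \in SD la by apply/mem_SDP; split; lia.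
  have b1 : (i.+1, (i.+1 + inner_len i.+2)%N) \in SD la by apply: SD_up b2.
  have small2 : T' (i.+2, (i.+1 + inner_len i.+2)%N) != fset0 by rewrite E2 //; lia.
  have : T' (i.+1, (i.+1 + inner_len i.+2)%N) != fset0.
    apply/negP => /eqP /(small_or_last b1) hT.
    by apply: (last_above_small hT small2); rewrite eqxx ltnSn orbT.
  by rewrite E1 //; lia.
have nuP i : (0 < i)%N -> part nu i = inner_len i by move=> i0; rewrite -nulE // /part nuE.
have okk : shape_ok (odd h) q la nu sg.
  split.
  - move=> i i0; rewrite nuP // sgE // leqNgt; apply/negP => lt.
    have [le1 E1] := inner_lenP i0; have [le2 E2] := start_posP i0.
    have bb : (i, (i + inner_len i)%N) \in SD la by apply: box_mem; lia.
    have := @small_or_last _ _ bb; rewrite E2 // => imp; have := E1 _ bb; rewrite ltnn =>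
      /negbFE/eqP/imp; lia.
  - by move=> i i0; rewrite nuP //; case: (inner_lenP i0).
  - move=> i i0; rewrite nuP // sgE // leqNgt; apply/negP => lt.
    have [le1 E1] := inner_lenP i0; have [le2 E2] := start_posP i0.
    apply: (@last_above_small i i (i + start_pos i)%N (i + (start_pos i).+1)%N).
    + by rewrite E2 //; apply: box_mem; lia.
    + by rewrite E1; [lia | apply: box_mem; lia].
    + by rewrite eqxx; lia.
  - move=> i i0; rewrite !nuP // sgE // => lt.
    have [le1 E1] := inner_lenP i0; have [le2 E2] := start_posP i0.
    have [le3 E3] := inner_lenP (isT : 0 < i.+1)%N.
    case: (posnP (inner_len i.+1)) => [->|n0]; [by left | right].
    have := part_strict spn i0; rewrite !nuP // => -[|st]; first by lia.
    rewrite ltnNge; apply/negP => ge.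
    (* Otherwise the row below reaches the column of the shared box and puts a small entry under the
       last letter. *)
    apply: (@last_above_small i i.+1 (i + (inner_len i).-1)%N (i + (inner_len i).-1)%N).
    + by rewrite E2; [lia | apply: box_mem; lia].
    + by rewrite E3; [lia | apply/mem_SDP; split; lia].
    + by rewrite eqxx ltnSn orbT.
  - move=> uh i i0; rewrite sgE //; have [le2 E2] := start_posP i0.
    case: (posnP (part la i.+1)) => [->|n0]; [by left | right].
    rewrite ltnNge; apply/negP => ge.
    (* This is the last box of row i+1. With the last letter above it, it holds no small entry, so
       the unprimed letter repeats in the column. *)
    have b2 : (i.+1, (i + part la i.+1)%N) \in SD la by apply/mem_SDP; split; lia.
    have b1 : (i, (i + part la i.+1)%N) \in SD la by apply: SD_up b2.
    have h1 : h.+1 \in T (i, (i + part la i.+1)%N) by rewrite E2 //; lia.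
    have h2 : h.+1 \in T (i.+1, (i + part la i.+1)%N).
      apply: small_or_last => //; apply/eqP/negPn/negP => sm.
      by apply: (last_above_small h1 sm); rewrite eqxx ltnSn orbT.
    by have := S3 _ _ _ _ _ h1 h2; rewrite /is_primed /= uh => /(_ isT); lia.
  - move=> uh i i0; rewrite sgE //; have [le2 E2] := start_posP i0.
    rewrite leqNgt; apply/negP => lt.
    have h1 : h.+1 \in T (i, (i + start_pos i)%N) by rewrite E2 //; apply: box_mem; lia.
    have h2 : h.+1 \in T (i, (i + (start_pos i).+1)%N) by rewrite E2 //;
      [lia | apply: box_mem; lia].
    by have := S4 _ _ _ _ _ h1 h2; rewrite /is_primed /= uh => /(_ isT); lia.
  - move=> uh qq i i0; rewrite sgE // => s0; have [le2 E2] := start_posP i0.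
    case: (posnP (part la i)) => // l0.
    have /(dT qq) : h.+1 \in T (i, i) by rewrite E2; [lia | apply/mem_SDP; split; lia].
    by rewrite /is_primed /= uh.
have T'b : bounded_tab q h nu T'.
  split; first split.
  - case=> i j; split=> [T0|].
      have bl : (i, j) \in SD la.
        by case/fset0Pn: T0 => k; rewrite mem_restrict => /andP[/(bounded_mem TT)[]].
      have /mem_SDP[i0 ij jl] := bl; have [_ E] := inner_lenP i0.
      by apply/mem_SDP; split=> //; rewrite nuP // -E.
    move=> /mem_SDP[i0 ij jl]; have [le E] := inner_lenP i0; rewrite nuP // in jl.
    by rewrite E //; apply/mem_SDP; split=> //; lia.
  - by move=> c k; rewrite mem_restrict => /andP[/f2].
  - split=> [i j j' jj' k k'|i i' j ii' k k'|i i' j k ek|i j j' k ek]; rewrite !mem_restrict.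
    + by move=> /andP[kT _] /andP[kT' _]; exact: (S1 _ _ _ jj' _ _ kT kT').
    + by move=> /andP[kT _] /andP[kT' _]; exact: (S2 _ _ _ ii' _ _ kT kT').
    + by move=> /andP[kT _] /andP[kT' _]; exact: S3 ek kT kT'.
    + by move=> /andP[kT _] /andP[kT' _]; exact: S4 ek kT kT'.
  - by move=> qq j k; rewrite mem_restrict => /andP[/(dT qq)].
  - by move=> c k; rewrite mem_restrict => /andP[].
exists nu, sg; split=> //; first by rewrite !hd_part; case: okk => _ /(_ 1%N isT).
  by apply/(shape_okP _ _ _ _ spl); split=> //; [rewrite size_mkseq | move: snu;
    rewrite size_mkseq].
apply/fsfunP => -[i j]; apply/fsetP => k; rewrite (mem_add_letter spl spn okk T'b) mem_restrict.
have [kh|kh] := leqP k h; first by rewrite andbT [k == _]ltn_eqF ?orbF.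
rewrite andbF /=; apply/idP/idP => [kT|/andP[/eqP-> /and3P[/= i0 ij jl]]].
  have [bl _ kh'] := bounded_mem TT kT; have /mem_SDP[i0 ij jl] := bl.
  have kE : k = h.+1 by lia.
  rewrite kE eqxx andTb; apply/and3P; split=> //=; have [_ E] := start_posP i0.
  by rewrite sgE // -(E _ bl) -kE.
by have [_ E] := start_posP i0; rewrite E -?sgE //; apply/mem_SDP; split=> //; lia.
Qed.

End Restrict.

(** * Enumeration and weights of tableaux *)

Fixpoint tabs (q : bool) (N h : nat) (la : seq nat) : seq tableau :=
  if h is h'.+1 then
    [seq add_letter h la p.1.2 p.2 |
       p <- [seq (s, T) | s <- [seq (nu, sg) | nu <- strict_parts N, sg <- starts (odd h') q la nu],
                          T <- tabs q N h' s.1]]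
  else if la == [::] then [:: [fsfun]] else [::].

Lemma bounded_tab0 q la T : strict_partition la ->
  bounded_tab q 0 la T <-> la = [::] /\ T = [fsfun].
Proof.
move=> spl; split=> [TT|[-> ->]].
  have T0 c : T c = fset0.
    by apply/fsetP => k; rewrite inE; apply/negP => /(bounded_mem TT)[]; lia.
  split; last by apply/fsfunP => c; rewrite T0 fsfun0E.
  case: la spl TT => // a la; rewrite strict_partition_cons => /and3P[a0 _ _] [[f _] _ _ _].
  have /f : (1, 1)%N \in SD (a :: la) by apply/mem_SDP; split; rewrite /part /=; lia.
  by rewrite T0 eqxx.
have no c k : k \in ([fsfun] : tableau) c = false by rewrite fsfun0E inE.
split=> [||_ j k|c k]; rewrite ?no //.
  split=> [c|c k]; last by rewrite no.
  rewrite fsfun0E eqxx; split=> //; case: c => i j /mem_SDP[i0 ij].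
  by rewrite /part nth_nil; lia.
by split=> [i j j' _ k k'|i i' j _ k k'|i i' j k _|i j j' k _]; rewrite no.
Qed.

Lemma mem_tabs q N h la T : strict_partition la -> (hd la <= N)%N ->
  T \in tabs q N h la <-> bounded_tab q h la T.
Proof.
elim: h la T => [|h IH] la T spl laN /=.
  rewrite bounded_tab0 //; case: eqP => la0; last by split=> // -[].
  by rewrite inE; split=> [/eqP|[_ ->]].
split=> [/mapP[[[nu sg] T'] /allpairsPdep[[nu0 sg0] [T0 [/allpairsPdep[nu1 [sg1 [nuN sgs [-> ->]]]]]]]]|TT].
  move=> T0s [-> -> ->] -> /=; move: nuN T0s; rewrite mem_strict_parts => /andP[spn nuN] /=.
  move=> /(IH _ _ spn nuN) TT0.
  have [_ _ okk] := (shape_okP (odd h) q nu1 sg1 spl).1 sgs.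
  exact: (add_letter_bounded spl spn okk TT0).
have [nu [sg [spn nula sgs T'T ->]]] := restrict_tab spl TT.
have nuN : (hd nu <= N)%N by apply: leq_trans laN.
apply/mapP; exists ((nu, sg), restrict h la T) => //.
apply/allpairsPdep; exists (nu, sg), (restrict h la T); split=> //.
  by apply/allpairsPdep; exists nu, sg; split=> //; rewrite mem_strict_parts spn.
by apply/IH.
Qed.

Lemma bounded_shape q h la mu T : strict_partition la -> strict_partition mu ->
  bounded_tab q h la T -> bounded_tab q h mu T -> la = mu.
Proof.
move=> spl spm [[f1 _] _ _ _] [[g1 _] _ _ _]; apply: SD_inj => // c.
by apply/idP/idP => [/f1/g1|/g1/f1].
Qed.

(** The entries up to [h] recover the smaller tableau and with it the shape. The boxes with h+1
    recover the start positions, since these do not exceed the rows of [la]. *)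
Lemma add_letter_inj q h la nu1 sg1 T1 nu2 sg2 T2 : strict_partition la ->
  strict_partition nu1 -> strict_partition nu2 ->
  sg1 \in starts (odd h) q la nu1 -> sg2 \in starts (odd h) q la nu2 ->
  bounded_tab q h nu1 T1 -> bounded_tab q h nu2 T2 ->
  add_letter h.+1 la sg1 T1 = add_letter h.+1 la sg2 T2 ->
  [/\ nu1 = nu2, sg1 = sg2 & T1 = T2].
Proof.
move=> spl sp1 sp2 s1 s2 TT1 TT2 E.
have [ss1 _ ok1] := (shape_okP (odd h) q nu1 sg1 spl).1 s1.
have [ss2 _ ok2] := (shape_okP (odd h) q nu2 sg2 spl).1 s2.
have E' c k : (k \in T1 c) || ((k == h.+1) && in_strip la sg1 c)
            = (k \in T2 c) || ((k == h.+1) && in_strip la sg2 c).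
  by rewrite -(mem_add_letter spl sp1 ok1 TT1) -(mem_add_letter spl sp2 ok2 TT2) E.
have TE : T1 = T2.
  apply/fsfunP => c; apply/fsetP => k; have := E' c k.
  have [kh|kh] := ltnP h k; last by rewrite [k == _]ltn_eqF // !orbF.
  by move=> _; apply/idP/idP => [/(bounded_mem TT1)|/(bounded_mem TT2)] []; lia.
have sE c : in_strip la sg1 c = in_strip la sg2 c.
  have := E' c h.+1; rewrite eqxx !andTb.
  have -> : (h.+1 \in T1 c) = false by apply/negP => /(bounded_mem TT1)[]; lia.
  by have -> : (h.+1 \in T2 c) = false by apply/negP => /(bounded_mem TT2)[]; lia.
split=> //; first by apply: (bounded_shape sp1 sp2 TT1); rewrite TE.
apply: (@eq_from_nth _ 0%N); rewrite ?ss1 ?ss2 // => i il.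
have key sg sg' : (forall c, in_strip la sg c -> in_strip la sg' c) ->
  (part sg' i.+1 <= part la i.+1)%N -> (part sg i.+1 <= part la i.+1)%N ->
  (part sg' i.+1 <= part sg i.+1)%N.
  move=> sub le' le; rewrite leqNgt; apply/negP => lt.
  have /sub/and3P[/=] : in_strip la sg (i.+1, (i.+1 + part sg i.+1)%N) by apply/and3P;
    split=> /=; lia.
  by lia.
have l1 : (part sg1 i.+1 <= part la i.+1)%N.
  by apply: leq_trans (inner_le ok1 (isT : 0 < i.+1)%N); apply: (start_le ok1).
have l2 : (part sg2 i.+1 <= part la i.+1)%N.
  by apply: leq_trans (inner_le ok2 (isT : 0 < i.+1)%N); apply: (start_le ok2).
by apply/eqP; rewrite eqn_leq; apply/andP; split; apply: (key _ _ _ _ _) => // c; rewrite sE.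
Qed.

Lemma uniq_tabs q N h la : strict_partition la -> (hd la <= N)%N -> uniq (tabs q N h la).
Proof.
elim: h la => [|h IH] la spl laN /=; first by case: eqP.
rewrite map_inj_in_uniq.
  apply: allpairs_uniq_dep => [|[nu sg] /allpairsPdep[nu1 [sg1 [+ _ [-> _]]]]|].
  - apply: allpairs_uniq_dep => [|nu _|]; [exact: uniq_strict_parts|exact: uniq_starts|].
    by move=> [? ?] [? ?] _ _ /= [-> ->].
  - by rewrite mem_strict_parts => /andP[spn nuN]; apply: IH.
  - by move=> [? ?] [? ?] _ _ /= [-> ->].
move=> [[nu1 sg1] T1] [[nu2 sg2] T2].
move=> /allpairsPdep[[? ?] [? [/allpairsPdep[? [? [m1 s1 [-> ->]]]] t1 [-> -> ->]]]].
move=> /allpairsPdep[[? ?] [? [/allpairsPdep[? [? [m2 s2 [-> ->]]]] t2 [-> -> ->]]]] /= E.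
move: m1 m2; rewrite !mem_strict_parts => /andP[p1 n1] /andP[p2 n2].
have [] := add_letter_inj spl p1 p2 s1 s2 _ _ E; first exact/(mem_tabs _ _ _ p1 n1).
  exact/(mem_tabs _ _ _ p2 n2).
by move=> -> -> ->.
Qed.

(** * Counting occurrences of letters *)

Lemma occE (T : tableau) D k : finsupp T `<=` D -> occ T k = (\sum_(c <- D) (k \in T c))%N.
Proof.
move=> sD; apply: big_fset_incl => // c _; rewrite mem_finsupp negbK => /eqP->.
by rewrite inE.
Qed.

Lemma finsupp_bounded q h la T : bounded_tab q h la T -> finsupp T = SD la.
Proof.
move=> [[f _] _ _ _]; apply/fsetP => c; rewrite mem_finsupp.
by apply/idP/idP => /f.
Qed.

Lemma cardfs_bounded (X : {fset nat}) h : (forall k, k \in X -> (0 < k <= h)%N) ->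
  #|` X| = (\sum_(k < h) (k.+1 \in X))%N.
Proof.
move=> bd; rewrite -(big_mkord xpredT (fun k => nat_of_bool (k.+1 \in X))).
have -> : (\sum_(0 <= k < h) (k.+1 \in X) = \sum_(k <- iota 1 h | k \in X) 1)%N.
  rewrite [RHS]big_mkcond /= /index_iota subn0 -[in RHS](addn0 1%N) iotaDl big_map.
  by apply: eq_bigr => k _; case: ifP.
rewrite sum1_count -size_filter; apply: perm_size; apply: uniq_perm => [||k] //.
  exact/filter_uniq/iota_uniq.
by rewrite mem_filter mem_iota add1n ltnS; apply/idP/andP => [kX|[]//]; split=> //; apply: bd.
Qed.

Lemma size_tab_occ q h la T : bounded_tab q h la T ->
  size_tab T = (\sum_(k < h) occ T k.+1)%N.
Proof.
move=> TT; rewrite exchange_big /=; apply: eq_bigr => c _; apply: cardfs_bounded => k.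
by move=> /(bounded_mem TT)[_ -> ->].
Qed.

Lemma sum_SD la (F : nat * nat -> nat) :
  (\sum_(c <- SD la) F c =
   \sum_(i <- iota 0 (size la)) \sum_(k <- iota 0 (nth 0 la i)) F (i.+1, i.+1 + k))%N.
Proof.
transitivity (\sum_(c <- [seq (i.+1, (i.+1 + k)%N) | i <- iota 0 (size la),
   k <- iota 0 (nth 0%N la i)]) F c)%N; last by rewrite big_allpairs_dep.
apply: perm_big; apply: uniq_perm => [//||[i j]].
  apply: allpairs_uniq_dep => [|i _|]; rewrite ?iota_uniq //.
  by move=> [i k] [i' k'] _ _ /= [-> /addnI->].
apply/mem_SDP/allpairsPdep => [[i0 ij jl]|[i' [k [+ + [-> ->]]]]].
  exists i.-1, (j - i)%N; rewrite !mem_iota prednK // subnKC // /part in jl *; split=> //.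
    rewrite /= add0n; case: ltnP => // il; rewrite nth_default // in jl; lia.
  by rewrite /= add0n; lia.
by rewrite !mem_iota /= !add0n => il kl; split; rewrite /part /=; lia.
Qed.

Lemma sumn_nth l : sumn l = (\sum_(i <- iota 0 (size l)) nth 0 l i)%N.
Proof. by rewrite sumnE (big_nth 0%N) /index_iota subn0. Qed.

Lemma sum_iota_ge s a : (s <= a)%N -> (\sum_(k <- iota 0 a | s <= k) 1 = a - s)%N.
Proof.
move=> sa; rewrite -{1}(subnKC sa) iotaD big_cat /= big1_seq ?add0n => [|k]; last
  by rewrite mem_iota; lia.
rewrite -big_filter (_ : [seq _ <- _ | _] = iota s (a - s)) ?sum1_size ?size_iota //.
by apply/all_filterP/allP => k; rewrite mem_iota => /andP[].
Qed.

Lemma occ_add_letter_last q h la nu sg T : strict_partition la -> strict_partition nu ->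
  sg \in starts (odd h) q la nu -> bounded_tab q h nu T ->
  occ (add_letter h.+1 la sg T) h.+1 = (sumn la - sumn sg)%N.
Proof.
move=> spl spn sgs TT; have [ssg _ okk] := (shape_okP (odd h) q nu sg spl).1 sgs.
have AA := add_letter_bounded spl spn okk TT.
rewrite /occ (finsupp_bounded AA) sum_SD.
have le i : (nth 0%N sg i <= nth 0%N la i)%N.
  by apply: leq_trans (inner_le okk (isT : 0 < i.+1)%N);
    apply: (start_le okk (isT : 0 < i.+1)%N).
transitivity (\sum_(i <- iota 0 (size la)) (nth 0%N la i - nth 0%N sg i))%N.
  apply: eq_bigr => i _; set a := nth 0%N la i.
  transitivity (\sum_(k <- iota 0 a | nth 0%N sg i <= k) 1)%N.
    rewrite [RHS]big_mkcond /= !big_seq; apply: eq_bigr => k; rewrite mem_iota => /andP[_ ka].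
    rewrite (mem_add_letter spl spn okk TT) eqxx andTb.
    have -> : (h.+1 \in T (i.+1, (i.+1 + k)%N)) = false by apply/negP => /(bounded_mem TT)[];
      lia.
    by rewrite /in_strip /part /= leq_add2l ltn_add2l -/a ka andbT; case: leqP.
  exact: sum_iota_ge.
by rewrite !sumn_nth ssg -sumnB // => i _; apply: le.
Qed.

Lemma occ_add_letter_small q h la nu sg T k : strict_partition la -> strict_partition nu ->
  sg \in starts (odd h) q la nu -> bounded_tab q h nu T -> (k <= h)%N ->
  occ (add_letter h.+1 la sg T) k = occ T k.
Proof.
move=> spl spn sgs TT kh; have [ssg _ okk] := (shape_okP (odd h) q nu sg spl).1 sgs.
have AA := add_letter_bounded spl spn okk TT.
rewrite (@occE _ (SD la)) ?(finsupp_bounded AA) // (@occE T (SD la)).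
  by apply: eq_bigr => c _; rewrite (mem_add_letter spl spn okk TT) [k == _]ltn_eqF ?orbF.
by rewrite (finsupp_bounded TT); apply/fsubsetP => c; apply: (SD_inner spl spn okk).
Qed.

(** * Weighted sums over tableaux *)

Section Weight.
Variables (R : comNzRingType) (b : R) (x : nat -> R).

Definition wt h la (T : tableau) : R :=
  b ^+ (size_tab T - sumn la) * \prod_(k < h) x k./2 ^+ occ T k.+1.

(** Needed because the exponent of b in [wt] is a truncated difference. *)
Lemma size_tab_ge q N h la T : strict_partition la -> (hd la <= N)%N -> T \in tabs q N h la ->
  (sumn la <= size_tab T)%N.
Proof.
elim: h la T => [|h IH] la T spl laN.
  by move=> /(mem_tabs _ _ _ spl laN)/(bounded_tab0 _ _ spl)[-> _].
move=> TT; have := TT => /(mem_tabs _ _ _ spl laN) bT; move: TT => /=.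
move=> /mapP[[[nu sg] T'] /allpairsPdep[[? ?] [? [/allpairsPdep[nu1 [sg1 [nuN sgs [-> ->]]]]]]]].
move: nuN; rewrite mem_strict_parts => /andP[spn nuN] /= tT [_ -> ->] TE.
have /(mem_tabs _ _ _ spn nuN) bT' := tT; have := IH _ _ spn nuN tT.
rewrite (size_tab_occ bT') (size_tab_occ bT) big_ord_recr /= TE (occ_add_letter_last spl spn sgs bT').
under [X in (_ -> _ <= X + _)%N]eq_bigr =>
  k _ do rewrite (occ_add_letter_small spl spn sgs bT') //.
by have := starts_sumn sgs; lia.
Qed.

Lemma wt_add_letter q N h la nu sg T : strict_partition la -> strict_partition nu ->
  (hd nu <= N)%N ->
  sg \in starts (odd h) q la nu -> T \in tabs q N h nu ->
  wt h.+1 la (add_letter h.+1 la sg T) =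
  x h./2 ^+ (sumn la - sumn sg) * b ^+ (sumn nu - sumn sg) * wt h nu T.
Proof.
move=> spl spn nuN sgs tT; have /(mem_tabs _ _ _ spn nuN) bT := tT.
have [_ _ okk] := (shape_okP (odd h) q nu sg spl).1 sgs.
have AA := add_letter_bounded spl spn okk bT.
rewrite /wt big_ord_recr /= (occ_add_letter_last spl spn sgs bT).
under eq_bigr => k _ do rewrite (occ_add_letter_small spl spn sgs bT) //.
(* The letter adds |la| - |sg| entries while the shape grows by |la| - |nu|, so the excess grows by
   |nu| - |sg|. *)
have -> : (size_tab (add_letter h.+1 la sg T) - sumn la =
   (sumn nu - sumn sg) + (size_tab T - sumn nu))%N.
  have := size_tab_ge spn nuN tT.
  rewrite (size_tab_occ AA) (size_tab_occ bT) big_ord_recr /= (occ_add_letter_last spl spn sgs bT).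
  under [X in (_ -> X + _ - _ = _)%N]eq_bigr =>
    k _ do rewrite (occ_add_letter_small spl spn sgs bT) //.
  by have := starts_sumn sgs; lia.
by rewrite exprD [X in _ * X = _]mulrC mulrACA [X in X * _ = _]mulrC.
Qed.

(** Tableaux are grouped by the shape [nu] of their smaller letters; by [sum_starts] the start
    positions then add up to the kernel of the last letter. *)
Lemma sum_tabs q N h la : strict_partition la -> (hd la <= N)%N ->
  \sum_(T <- tabs q N h la) wt h la T = letter_sum b x N q h la.
Proof.
elim: h la => [|h IH] la spl laN /=.
  case: eqP => [->|_]; last by rewrite big_nil.
  rewrite big_seq1 /wt big_ord0 mulr1 subn0.
  suff -> : size_tab [fsfun] = 0%N by [].
  by rewrite /size_tab finsupp0 big_nil.
rewrite big_map big_allpairs_dep /= big_allpairs_dep /= !big_seq; apply: eq_bigr => nu.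
rewrite mem_strict_parts => /andP[spn nuN]; rewrite -IH //.
have -> : letter_kern b x q h la nu =
  kern (if odd h then unprimed_row b (x h./2) else primed_row b (x h./2) q) la nu.
  by rewrite /letter_kern; case: (odd h).
rewrite -sum_starts // big_distrl /= !big_seq; apply: eq_bigr => sg sgs.
rewrite big_distrr /= !big_seq; apply: eq_bigr => T tT.
exact: (@wt_add_letter q N).
Qed.

End Weight.

(** * The expansion coefficients *)

(** Lets the coefficients, computed in Q[beta], be used as constants of the polynomial ring in the x
    variables. *)
Lemma strip_kern_morph (R S : comNzRingType) (f : {rmorphism R -> S}) b mu la :
  strip_kern (f b) mu la = f (strip_kern b mu la).
Proof.
elim: mu la => [|a mu IH] la; first by rewrite /strip_kern /= rmorph_nat.
rewrite /strip_kern /= rmorphM -IH; congr (_ * _); rewrite /strip_row /sgn rmorphM.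
by congr (_ * _); do ![case: ifP => _]; rewrite ?rmorphN ?rmorph1 ?rmorph0 ?rmorph_nat.
Qed.

(** A decidable form of [strip_ext] by row lengths; see [strip_extP]. *)
Definition unit_steps (mu la : seq nat) : bool :=
  (size la == size mu) && all2 (fun a c => (c == a) || (c == a.+1)) mu la.

Lemma unit_steps_cons a mu c la :
  unit_steps (a :: mu) (c :: la) = ((c == a) || (c == a.+1)) && unit_steps mu la.
Proof. by rewrite /unit_steps /= eqSS andbCA. Qed.

Lemma unit_stepsP mu la : reflect
  (size la = size mu /\ forall i, (nth 0%N mu i <= nth 0%N la i <= (nth 0%N mu i).+1)%N)
  (unit_steps mu la).
Proof.
elim: mu la => [|a mu IH] [|c la]; rewrite ?unit_steps_cons.
- by constructor; split=> // i; rewrite nth_nil.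
- by constructor; case.
- by constructor; case.
apply: (iffP andP) => [[ac /IH[sz st]]|[[sz] st]].
  by split=> [|[|i]] //=; [rewrite sz | lia].
by split; [have := st 0%N => /=; lia | apply/IH; split=> // i; exact: (st i.+1)].
Qed.

Lemma strip_kern_unit_steps (R : comNzRingType) (b : R) mu la : ~~ unit_steps mu la ->
  strict_partition mu -> strip_kern b mu la = 0.
Proof.
elim: mu la => [|a mu IH] [|c la] //=.
  by rewrite strict_partition_cons => _ /and3P[a0 _ _];
    rewrite /strip_kern /= strip_row_supp ?mul0r //; lia.
rewrite unit_steps_cons negb_and negb_or strict_partition_cons =>
  /orP[/andP[ca ca1]|nu] /and3P[_ _ spm].
  by rewrite /strip_kern /= strip_row_supp ?mul0r.
by have := IH _ nu spm; rewrite /strip_kern /= => ->; rewrite mulr0.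
Qed.

(** Columns of the added boxes, with repetitions. Columns of the tail are shifted because row i
    starts in column i. *)
Fixpoint new_cols (mu la : seq nat) : seq nat :=
  match mu, la with
  | a :: mu', c :: la' =>
      (if c == a then [::] else [:: a.+1]) ++ [seq j.+1 | j <- new_cols mu' la']
  | _, _ => [::]
  end.

Lemma new_colsP mu la j : unit_steps mu la ->
  reflect (exists i, [/\ (0 < i)%N, (i + part mu i <= j)%N & (j < i + part la i)%N])
          (j \in new_cols mu la).
Proof.
elim: mu la j => [|a mu IH] [|c la] j //=.
  by move=> _; constructor => -[i []]; rewrite /part nth_nil; lia.
rewrite unit_steps_cons => /andP[ac us]; rewrite mem_cat; apply: (iffP orP).
  case; first by case: eqP ac => //= _ /eqP->; rewrite inE => /eqP->; exists 1%N;
    rewrite /part /=; split; lia.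
  move=> /mapP[j' /(IH _ _ us)[i [i0 le lt]] ->]; exists i.+1; move: le lt; rewrite /part /=.
  by case: i i0 => //= i _; split; lia.
case=> [[|[|i]] []] //; rewrite /part /= => _ le lt.
  left; case: eqP ac => /= [ca|_ /eqP ca]; first by lia.
  by rewrite inE; lia.
right; apply/mapP; exists j.-1; last by lia.
by apply/(IH _ _ us); exists i.+1; rewrite /part /=; split; lia.
Qed.

Lemma new_cols_le mu la j : unit_steps mu la -> strict_partition la ->
  j \in new_cols mu la -> (j <= hd la)%N.
Proof.
elim: mu la j => [|a mu IH] [|c la] j //=.
rewrite unit_steps_cons strict_partition_cons mem_cat => /andP[ac us] /and3P[_ lac spl] /orP[].
  by case: eqP ac => //= _ /eqP->; rewrite inE => /eqP->.
by move=> /mapP[j' /(IH _ _ us spl) jl ->]; lia.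
Qed.

(** Here z stands for -b/2. A new box contributes 2z = -b, with a further sign when its column is
    not yet counted; a repeated column shows up as the sign [sgn]. *)
Lemma strip_kern_value (R : comNzRingType) (b z : R) mu la : strict_partition mu ->
  strict_partition la -> unit_steps mu la ->
  2 * z = - b ->
  strip_kern b mu la = 2 ^+ size mu * ((-1) ^+ size (undup (new_cols mu la)) *
    z ^+ (sumn la - sumn mu)).
Proof.
move=> + + + zb; elim: mu la => [|a mu IH] [|c la] //.
  by rewrite /strip_kern /= !expr0 !mulr1.
rewrite unit_steps_cons !strict_partition_cons =>
  /and3P[a0 ma spm] /and3P[c0 lac spl] /andP[ac us].
rewrite /strip_kern /= -/(strip_kern b mu la) IH // /strip_row /sgn.
have le : (sumn mu <= sumn la)%N.
  elim: mu la us {IH lac ma spm spl} => [|a' mu IH] [|c' la] //=; rewrite unit_steps_cons =>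
    /andP[h /IH h'].
  by lia.
have -> : (c + sumn la - (a + sumn mu) = (c - a) + (sumn la - sumn mu))%N by lia.
have sz : size (undup [seq j.+1 | j <- new_cols mu la]) = size (undup (new_cols mu la)).
  by rewrite undup_map_inj ?size_map // => ? ? [].
have [ca|ca] := eqVneq c a.
  rewrite cat0s sz ca subnn add0n exprS.
  by rewrite ifF; [rewrite mulr1 !mulrA | apply/negbTE; lia].
have cE : c = a.+1 by lia.
rewrite cE eqxx /= mem_map; last by move=> ? ? [].
(* Columns of the tail are at most [hd la], which is at most [(hd mu).+1] and so at most [a]. Hence
   column [a] occurs only if equality holds throughout. *)
have -> : (a \in new_cols mu la) = (a == (hd mu).+1) && (hd la == (hd mu).+1).
  apply/idP/andP => [am|[/eqP E1 /eqP E2]].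
    have := new_cols_le us spl am; case: mu la us am {IH le sz spm spl} ma lac =>
      [|a' mu] [|c' la] //=.
    by rewrite unit_steps_cons => /andP[h _] _; lia.
  case: mu la us {IH le sz spm spl lac} ma E1 E2 => [|a' mu] [|c' la] //=.
  by rewrite /= => _ _ -> ->; rewrite ifF ?mem_head //; lia.
have -> : (a.+1 - a = 1)%N by lia.
rewrite exprD expr1 [2 ^+ (size mu).+1]exprS.
have -> : b = - (2 * z) by rewrite zb opprK.
by case: ifP => _; rewrite /= sz ?exprS; ring.
Qed.

Lemma cardfs_SD la : #|` SD la| = sumn la.
Proof.
rewrite -sum1_size sum_SD sumn_nth.
by apply: eq_bigr => i _; rewrite sum1_size size_iota.
Qed.

Lemma mem_SDskewP la mu i j : reflect
  [/\ (0 < i)%N, (i + part mu i <= j)%N & (j < i + part la i)%N] ((i, j) \in SDskew la mu).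
Proof.
rewrite in_fsetD; apply: (iffP andP) => [[/mem_SDP nm /mem_SDP[i0 ij jl]]|[i0 ij jl]].
  by split=> //; rewrite leqNgt; apply/negP => jm; apply: nm.
by split; [apply/mem_SDP => -[_ _]; lia | apply/mem_SDP; split=> //; lia].
Qed.

Lemma size_skewE mu la : unit_steps mu la -> size_skew la mu = (sumn la - sumn mu)%N.
Proof.
move=> /unit_stepsP[sz st]; rewrite /size_skew cardfsD !cardfs_SD; congr (_ - _)%N.
rewrite -cardfs_SD; congr #|` _|; apply/fsetIidPr/fsubsetP => -[i j] /mem_SDP[i0 ij jl].
by apply/mem_SDP; split=> //; have := st i.-1; rewrite /part in jl *; lia.
Qed.

Lemma colsE mu la : unit_steps mu la -> cols la mu = size (undup (new_cols mu la)).
Proof.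
move=> us; rewrite /cols; apply: perm_size; apply: uniq_perm => [||j]; rewrite ?undup_uniq //.
rewrite mem_undup; apply/imfsetP/(new_colsP _ us) => [[[i j'] /= /mem_SDskewP ij ->]|[i ij]].
  by exists i.
by exists (i, j) => //=; apply/mem_SDskewP.
Qed.

Lemma strip_extP mu la : strict_partition la -> strip_ext mu la <-> unit_steps mu la.
Proof.
move=> spl; split=> [[_ sub sz vs]|us].
  apply/unit_stepsP; split=> // i; have := sub i.+1 isT; rewrite /part /= => -> /=.
  rewrite leqNgt; apply/negP => lt.
  have h1 : (i.+1, (i.+1 + part mu i.+1)%N) \in SDskew la mu.
    by apply/mem_SDskewP; rewrite /part /=; split; lia.
  have h2 : (i.+1, (i.+1 + part mu i.+1).+1)%N \in SDskew la mu.
    by apply/mem_SDskewP; rewrite /part /=; split; lia.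
  by have := vs _ _ _ h1 h2; lia.
have /unit_stepsP[sz st] := us; split=> //.
  by move=> [|i] // _; rewrite /part /=; have := st i; lia.
move=> i j1 j2 /mem_SDskewP[i0 l1 r1] /mem_SDskewP[_ l2 r2].
by have := st i.-1; rewrite /part in l1 r1 l2 r2; lia.
Qed.

(** * Extracting coefficients *)

Lemma prod_double (R : comNzRingType) (F : nat -> R) n :
  \prod_(k < n.*2) F k = \prod_(i < n) (F i.*2 * F i.*2.+1).
Proof.
elim: n => [|n IH]; first by rewrite !big_ord0.
by rewrite doubleS !big_ord_recr /= IH mulrA.
Qed.

Definition xvar n (i : nat) : {mpoly {poly rat}[n]} :=
  if insub i is Some j then 'X_j else 0.

(** Beyond index n both [m] and the exponents of [T] vanish, so comparing the first n exponents
    decides [has_weight]. *)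
Lemma coef_wt q n la T (m : monomial) : bounded_tab q n.*2 la T ->
  (forall i, (n <= i)%N -> m i = 0%N) ->
  (wt 'X%:MP (@xvar n) n.*2 la T)@_[multinom m i | i < n] =
  if `[< has_weight T m >] then 'X^(size_tab T - sumn la) else 0.
Proof.
move=> TT m0; pose w := [multinom occ T i.*2.+1 + occ T i.*2.+2 | i < n]%N.
have -> : wt 'X%:MP (@xvar n) n.*2 la T = ('X^(size_tab T - sumn la))%:MP * 'X_[w].
  rewrite /wt (prod_double (fun k => @xvar n k./2 ^+ occ T k.+1)) mpolyXE_id rmorphXn;
    congr (_ * _); apply: eq_bigr => i _.
  rewrite mnmE exprD /= doubleK uphalf_double /xvar.
  by case: insubP => [j _ /val_inj ->|/negP[]] //; rewrite ltn_ord.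
rewrite mcoeffCM mcoeffX; case: asboolP => [wT|wT].
  suff -> : w == [multinom m i | i < n] by rewrite mulr1.
  by apply/eqP/mnmP => i; rewrite !mnmE wT /unprimed /primed doubleS addnC.
case: eqP => [/mnmP wm|_]; last by rewrite mulr0.
case: wT => i; rewrite /unprimed /primed doubleS /= addnC; have [ni|ni] := leqP n i.
  rewrite m0 //.
  have occ0 k : (n.*2 < k)%N -> occ T k = 0%N.
    move=> nk; rewrite /occ big1 // => c _; case: (boolP (k \in T c)) => // kT.
    by have [_ _] := bounded_mem TT kT; lia.
  by rewrite !occ0 //; lia.
by have := wm (Ordinal ni); rewrite !mnmE /=.
Qed.

(** A letter k > 2n would contribute to the exponent of index (k-1)/2, rounded down, which is at
    least n. *)
Lemma weight_bound la T (m : monomial) n c k : SetShYT_Q la T -> has_weight T m ->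
  (forall i, (n <= i)%N -> m i = 0%N) -> k \in T c -> (k <= n.*2)%N.
Proof.
move=> [[_ pos] _] wT m0 kT; have k0 := pos _ _ kT.
rewrite leqNgt; apply/negP => nk.
have : (0 < occ T k)%N.
  have cs : c \in finsupp T by rewrite mem_finsupp; apply/eqP => E; rewrite E in_fset0 in kT.
  by rewrite /occ (big_fsetD1 c) //= kT.
have := wT k.-1./2; rewrite m0; last by lia.
rewrite /unprimed /primed; have := odd_double_half k.-1.
case: (odd k.-1) => /= kE.
  have -> : (k.-1./2.+1.*2 = k)%N by lia.
  by lia.
have -> : (k.-1./2.*2.+1 = k)%N by lia.
by lia.
Qed.

(** The passage from power series to polynomials: the coefficient of a monomial in the first n
    variables sees only letters up to 2n. *)
Lemma coef_fsum q n N la (m : monomial) (S : set tableau) : strict_partition la ->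
  (hd la <= N)%N ->
  (forall i, (n <= i)%N -> m i = 0%N) ->
  (forall T, S T <-> bounded_tab q n.*2 la T /\ has_weight T m) ->
  map_poly intr (\sum_(T \in S) ('X^(size_tab T - sumn la) : {poly int})) =
  (letter_sum 'X%:MP (@xvar n) N q n.*2 la)@_[multinom m i | i < n].
Proof.
move=> spl laN m0 SP.
have -> : S = [set` [seq T <- tabs q N n.*2 la | `[< has_weight T m >]]]%classic.
  apply/seteqP; split=> T /=; rewrite mem_filter.
    by move=> /SP[TT wT]; apply/andP; split; [exact/asboolP | exact/mem_tabs].
  by move=> /andP[/asboolP wT /(mem_tabs _ _ _ spl laN) TT]; apply/SP.
rewrite -fsbig_seq; last exact/filter_uniq/uniq_tabs.
rewrite -sum_tabs // !raddf_sum /= big_filter big_mkcond /= !big_seq.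
apply: eq_bigr => T /(mem_tabs _ _ _ spl laN) TT; rewrite (coef_wt TT m0).
by case: ifP => // _; rewrite map_polyXn.
Qed.

Lemma toQ_GQ n N la (m : monomial) : strict_partition la -> (hd la <= N)%N ->
  (forall i, (n <= i)%N -> m i = 0%N) ->
  toQ (GQ la) m = (letter_sum 'X%:MP (@xvar n) N true n.*2 la)@_[multinom m i | i < n].
Proof.
move=> spl laN m0; apply: coef_fsum => // T; split=> [[QT wT]|[[fT sT _ _] wT]].
  have [fT sT] := QT; split=> //; split=> // c k; exact: (weight_bound QT wT m0).
by split.
Qed.

Lemma toQ_GP n N la (m : monomial) : strict_partition la -> (hd la <= N)%N ->
  (forall i, (n <= i)%N -> m i = 0%N) ->
  toQ (GP la) m = (letter_sum 'X%:MP (@xvar n) N false n.*2 la)@_[multinom m i | i < n].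
Proof.
move=> spl laN m0; apply: coef_fsum => // T; split=> [[[QT dT] wT]|[[fT sT dT _] wT]].
  have [fT sT] := QT; split=> //; split=> // c k; exact: (weight_bound QT wT m0).
by split=> //; split=> //; apply: dT.
Qed.

Lemma monomial_bound (m : monomial) : exists n, forall i, (n <= i)%N -> m i = 0%N.
Proof.
exists (\sum_(i <- finsupp m) i).+1 => i ni; apply/eqP; rewrite -[_ == _]negbK -mem_finsupp.
apply/negP => im; move: ni; rewrite (big_fsetD1 i) //=; lia.
Qed.

Theorem theorem1p1 (mu : seq nat) (hmu : strict_partition mu) :
  toQ (GQ mu) =
    (2 ^+ size mu : {poly rat}) *:
      (\sum_(la \in strip_ext mu)
         ((-1) ^+ cols la mu * (- (2^-1 *: 'X)) ^+ size_skew la mu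
            : {poly rat}) *: toQ (GP la)).
Proof.
(* Coefficients are compared one at a time, each in a polynomial ring with enough variables for its
   monomial. *)
apply/funext => m; have [n m0] := monomial_bound m.
have [N NE] : exists N, N = (hd mu).+1 by exists (hd mu).+1.
have -> : strip_ext mu = [set` [seq la <- strict_parts N | unit_steps mu la]]%classic.
  apply/seteqP; split=> la /=; rewrite mem_filter mem_strict_parts.
    move=> Sla; have [spl _ _ _] := Sla; have us := (strip_extP mu spl).1 Sla.
    rewrite us spl /= NE -!nth0; have /unit_stepsP[_ /(_ 0%N)] := us; lia.
  by move=> /and3P[us spl _]; apply/strip_extP.
rewrite -fsbig_seq; last exact/filter_uniq/uniq_strict_parts.
rewrite scalrfctE fct_sumE (@toQ_GQ n N) //; last by rewrite NE.
rewrite letter_sum_expansion ?NE // -NE raddf_sum /= big_filter scaler_sumr [RHS]big_mkcond /= [LHS]big_seq [RHS]big_seq.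
apply: eq_bigr => la; rewrite mem_strict_parts => /andP[spl laN].
have -> : strip_kern ('X%:MP : {mpoly {poly rat}[n]}) mu la = (strip_kern 'X mu la)%:MP
  by rewrite -strip_kern_morph.
rewrite mcoeffCM -(toQ_GP spl laN m0); case: ifP => us; last first.
  by rewrite strip_kern_unit_steps ?us // mul0r.
(* Over the rationals z = -beta/2 is available, and it satisfies 2z = -beta. *)
rewrite (@strip_kern_value _ 'X (- (2^-1 *: 'X))) //; last first.
  by rewrite mulrN mulr_natl scalerMnl -mulr_natr mulVf ?scale1r.
by rewrite colsE // size_skewE // -mulrA.
Qed.
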